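(* Let $q$ be a power of a prime $p\neq 2,3$ with $q\equiv 2\pmod 3$, and write $q+1=3^dN$ with $\gcd(3,N)=1$. Consider the Hessian graph over $\mathbb{F}_q$, i.e. the functional graph of $\mathrm{Hess}:\mathbb{P}^1(\mathbb{F}_q)\to\mathbb{P}^1(\mathbb{F}_q)$, $[u:v]\mapsto[(u-6912v)^3:-27u^2v]$ (in the affine chart, $j\mapsto \frac{(6912-j)^3}{27j^2}$, with $\infty=[1:0]$). Then: (1) There are exactly $N$ periodic elements. Two of them ($j=1728$ and $j=\infty$) are self-loops and have indegree $3$, while the others lie on cycles of even length, along which elements of indegree $1$ and indegree $3$ alternate. (2) The trees attached to the periodic elements of indegree $3$ are all isomorphic. All leaves of such trees have depth $2d$, and an element of such a tree has indegree $0$ if it is a leaf, $3$ if it has even depth and is not a leaf, and $1$ if it has odd depth.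
   Context: A point is periodic if some iterate of $\mathrm{Hess}$ fixes it; the indegree of a vertex is its number of preimages in $\mathbb{P}^1(\mathbb{F}_q)$. The tree attached to a periodic element $P$ consists of $P$ together with all non-periodic elements some iterate of which equals $P$, with edges $Q\to\mathrm{Hess}(Q)$ (excluding the edge out of $P$); the depth of a node is the number of iterations needed to reach the root.
   Formalization: ∞ and 1728 have only 2 distinct preimages, so their indegree 3 counts multiplicity; their trees are isomorphic to each other, and to the others only with root branches counted with multiplicity; the tree at P has only elements whose orbit meets the cycle first at P. *)

(* Defs.v *)
From HB Require Import structures.
From mathcomp Require Import all_boot all_order all_algebra.
From mathcomp Require Import ring.

Set Implicit Arguments.
Unset Strict Implicit.
Unset Printing Implicit Defensive.

Import GRing.Theory.

Local Open Scope ring_scope.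

Section HessianGraph.

Variable F : finFieldType.

(* The projective line over F: [None] is [1:0] and [Some x] is [x:1]. *)
Definition P1 : finType := option F.

Definition homog (u v : F) : P1 := if v == 0 then None else Some (u / v).

Definition coords (P : P1) : F * F :=
  if P is Some x then (x, 1) else (1, 0).

Definition infty : P1 := None.
Definition affine (x : F) : P1 := Some x.

(* 4 * 1728 = 6912 *)
Definition Hess (P : P1) : P1 :=
  let: (u, v) := coords P in
  homog ((u - (4 * 1728)%:R * v) ^+ 3) (- (27%:R * u ^+ 2 * v)).

(* The formula for Hess is valid for all homogeneous coordinates. *)
Lemma Hess_homog (u v : F) : (u != 0) || (v != 0) ->
  Hess (homog u v) =
  homog ((u - (4 * 1728)%:R * v) ^+ 3) (- (27%:R * u ^+ 2 * v)).
Proof.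
rewrite /Hess /homog; have [-> /= | v0 _ /=] := eqVneq v 0.
  by rewrite !mulr0 oppr0 eqxx.
move: (4 * 1728)%:R 27%:R => c e.
rewrite !mulr1 !oppr_eq0 !mulf_eq0 invr_eq0 (negPf v0) !orbF.
case: ifP => // /norP[e0 /norP[u0 _]]; congr Some.
by field; rewrite !oppr_eq0 !mulf_neq0 ?expf_neq0 ?v0.
Qed.

Lemma coordsK (P : P1) : homog (coords P).1 (coords P).2 = P.
Proof. by case: P => [x|]; rewrite /homog /= ?eqxx ?oner_eq0 ?divr1. Qed.

Definition indegree (P : P1) : nat := #|[set Q | Hess Q == P]|.

(* The preimages of P = [a:b] are the zeros [u:v] of the binary cubic form
   b * (u - 6912 v)^3 + 27 a u^2 v; [mult P Q] is the order of vanishing of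
   this form at Q, computed in the chart v = 1 if Q is affine and in the chart
   u = 1 if Q = [1:0]. *)
Definition mult (P Q : P1) : nat :=
  let: (a, b) := coords P in
  match Q with
  | Some x => mup x (b *: ('X - ((4 * 1728)%:R)%:P) ^+ 3
                     + (27%:R * a) *: 'X^2)
  | None => mup 0 (b *: (1 - (4 * 1728)%:R *: 'X) ^+ 3
                   + (27%:R * a) *: 'X)
  end.

Definition indegree_mult (P : P1) : nat :=
  (\sum_(Q | Hess Q == P) mult P Q)%N.

Definition periodic (P : P1) : bool := fconnect Hess (Hess P) P.

Lemma periodicP (P : P1) :
  reflect (exists2 n, (0 < n)%N & iter n Hess P = P) (periodic P).
Proof.
apply: (iffP idP) => [/iter_findex eP | [[//|n] _ eP]].
  by exists (findex Hess (Hess P) P).+1; rewrite // iterSr.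
by rewrite /periodic -{2}eP iterSr fconnect_iter.
Qed.

(* Number of iterations needed to go from Q to P. *)
Definition depth (P Q : P1) : nat := findex Hess Q P.

(* The nodes whose forward orbit reaches P through non-periodic elements only:
   for P periodic this is the tree attached to P (elements that meet the cycle
   of P at another point are excluded); for P non-periodic it is the subtree
   of all elements above P. *)
Definition tree (P : P1) : {set P1} :=
  [set Q | fconnect Hess Q P
           && [forall i : 'I_(depth P Q), ~~ periodic (iter i Hess Q)]].

Definition tree_edge (P : P1) : rel P1 :=
  fun Q R => [&& Q \in tree P, R \in tree P, Q != P & Hess Q == R].

Definition leaf (P Q : P1) : bool :=
  (Q \in tree P) && ~~ [exists R, tree_edge P R Q].

Definition tree_iso (P P' : P1) : Prop :=
  exists f : P1 -> P1,
    [/\ {in tree P &, injective f}, f @: tree P = tree P', f P = P'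
      & {in tree P &, forall Q R,
          tree_edge P' (f Q) (f R) = tree_edge P Q R}].

(* The nodes of depth 1, each repeated according to its multiplicity as a
   preimage of the root. *)
Definition root_branches (P : P1) : seq P1 :=
  flatten [seq nseq (mult P Q) Q | Q <- enum P1 & tree_edge P Q P].

(* Isomorphism of the attached trees when every branch at the root is taken
   with its multiplicity: a bijection between the two lists of branches that
   matches isomorphic subtrees. *)
Definition tree_iso_mult (P P' : P1) : Prop :=
  exists t : seq P1,
    [/\ perm_eq t (root_branches P'), size (root_branches P) = size t
      & forall i, (i < size t)%N ->
          tree_iso (nth infty (root_branches P) i) (nth infty t i)].

End HessianGraph.

Arguments infty {F}.
Arguments Hess {F} P.
Arguments indegree_mult {F} P.

(* Main.v *)
(* Hess is a Lattes map: the curves y^2 = x^3 - 27 and y^2 = x^3 + 1 are linked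
   by isogenies alpha and beta of degree 3 whose composite is multiplication by
   3 up to sign, and the j-line is the quotient of either curve by its
   automorphisms of order 6.  As q = 2 mod 3, cubing is bijective on F and -3 is
   not a square; so each curve has q + 1 = 3^d N points, every point of the
   j-line except infinity and 1728 lifts to exactly one of the two curves,
   uniquely up to sign, alpha is bijective and beta is 3-to-1 onto its image.

   Only a shadow of the group law is needed: P, Q |-> the third point of the
   curve on the line PQ.  It is preserved by isogenies, since these send
   collinear triples to collinear triples, and this makes all nonempty fibers of
   the iterates of T = beta alpha equinumerous.  McKay's proof of Cauchy's
   theorem works for this operation and shows that T is 3-to-1 on the image of
   T^n exactly while 3 divides the size of that image, i.e. for n < d, and
   bijective on the image of T^d.  Hence y is in the image of T^(d - k) iff
   T^k y is periodic, which makes all trees full of height 2d. *)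

From HB Require Import structures.
From mathcomp Require Import fingroup perm action cyclic pgroup sylow.
From mathcomp Require Import all_boot all_order all_algebra all_field.
From mathcomp Require Import ring zify.
Require Import Defs.

Set Implicit Arguments.
Unset Strict Implicit.
Unset Printing Implicit Defensive.

Import GRing.Theory.

(** * Iterating an endomorphism of a totally symmetric quasigroup *)

(** [f] generates a [p]-group of permutations acting on [S], so every orbit has 1 or a multiple of
    [p] elements. *)
Lemma card_fixed_mod (V : finType) (f : V -> V) (S : {set V}) (p : nat) :
    prime p -> iter p f =1 id -> {in S, forall x, f x \in S} ->
  #|S| = #|[set x in S | f x == x]| %[mod p].
Proof.
move=> p_prime f_id f_S.
have p_gt0 := prime_gt0 p_prime.
have f_inj : injective f.
  move=> x y fxy; rewrite -[x]f_id -[y]f_id -(prednK p_gt0) !iterSr.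
  by rewrite fxy.
pose s := perm f_inj.
have sE x n : (s ^+ n)%g x = iter n f x.
  elim: n => [|n IH]; first by rewrite expg0 perm1.
  by rewrite expgSr permM IH permE.
have sp : (s ^+ p)%g = 1%g by apply/perm.permP=> x; rewrite sE f_id perm1.
have gP : pgroup p <[s]>%g.
  rewrite /pgroup -orderE; apply: (@pnat_dvd _ _ p); last exact: pnat_id.
  by rewrite order_dvdn sp.
have act : [acts <[s]>%g, on S | 'P].
  rewrite cycle_subG; apply/astabsP => x /=; rewrite /aperm.
  apply/idP/idP => [sx|Sx]; last by rewrite permE f_S.
  rewrite -(f_id x) -(prednK p_gt0) iterSr -[f x](permE f_inj).
  elim: (p.-1) => //= n IH; exact: f_S.
rewrite (pgroup_fix_mod gP act); congr (_ %% p)%N; apply: eq_card => x.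
rewrite in_setI [RHS]inE; congr (_ && _).
rewrite afix_cycle.
by apply/afix1P/eqP; rewrite /= /aperm permE.
Qed.

Section Descent.

(** The model is the third point on a line of a cubic, with [O] a flex. The solutions of
    [op x x = x] are the flexes, and [T] behaves like multiplication by 3 up to sign, whose kernel
    consists of them. *)
Variables (X : finType) (op : X -> X -> X) (O : X) (T : X -> X) (d N : nat).
Hypothesis opC : commutative op.
Hypothesis opK : forall x, involutive (op x).
Hypothesis opOO : op O O = O.
Hypothesis T_op : {morph T : x y / op x y}.
Hypothesis T_eqO : forall x, (T x == O) = (op x x == x).
Hypothesis card_flex : #|[set x | op x x == x]| = 3.
Hypothesis card_X : #|X| = 3 ^ d * N.
Hypothesis coprime_N : coprime 3 N.

Definition iter_im n : {set X} := [set iter n T x | x : X].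
Definition iter_ker n : {set X} := [set x | iter n T x == O].

Lemma iter_op n : {morph iter n T : x y / op x y}.
Proof. by elim: n => [|n IH] x y //=; rewrite IH T_op. Qed.

Lemma iter_O n : iter n T O = O.
Proof. by elim: n => //= n ->; apply/eqP; rewrite T_eqO opOO. Qed.

Lemma op_inj x : injective (op x).
Proof. exact: inv_inj. Qed.

(** The involution [op s'] plays the role of a translation: it carries the fiber over [O] to the
    fiber through [s = op s' O]. *)
Lemma card_iter_fiber n s :
  #|[set x | iter n T x == iter n T s]| = #|iter_ker n|.
Proof.
set s' := op O s.
have s'O : op s' O = s by rewrite opC opK.
rewrite -(card_imset _ (@op_inj s')); apply: eq_card => x.
rewrite -[x in LHS](opK s') (mem_imset _ _ (@op_inj s')) !inE.
rewrite -[in X in _ == X]s'O !iter_op iter_O.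
by rewrite (inj_eq (@op_inj _)).
Qed.

Lemma iter_im_op n : {in iter_im n &, forall x y, op x y \in iter_im n}.
Proof.
by move=> _ _ /imsetP[x _ ->] /imsetP[y _ ->]; rewrite -iter_op imset_f.
Qed.

Lemma iter_imO n : O \in iter_im n.
Proof. by apply/imsetP; exists O; rewrite ?iter_O. Qed.

Lemma mem_iter_im n x : iter n T x \in iter_im n.
Proof. exact: imset_f. Qed.

Lemma card_iter_preim n (S : {set X}) : S \subset iter_im n ->
  #|[set x | iter n T x \in S]| = #|iter_ker n| * #|S|.
Proof.
move=> sS; rewrite -sum1_card.
rewrite (partition_big (iter n T) (mem S)) /=; last by move=> x; rewrite inE.
rewrite (eq_bigr (fun=> #|iter_ker n|)); last first.
  move=> y Sy; have /imsetP[s _ ys] := subsetP sS _ Sy.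
  rewrite -(card_iter_fiber n s) sum1dep_card; apply: eq_card => x.
  by rewrite !inE -ys andbC; case: eqP => // ->.
by rewrite sum_nat_const mulnC.
Qed.

Lemma card_iter_im n : #|iter_ker n| * #|iter_im n| = #|X|.
Proof.
rewrite -(card_iter_preim (subxx _)) -cardsT; apply: eq_card => x.
by rewrite !inE mem_iter_im.
Qed.

(** A point is killed by [T^(n+1)] iff [T^n] sends it to a flex, and each flex in the image of [T^n]
    has a fiber as large as the kernel. *)
Lemma card_iter_kerS n :
  #|iter_ker n.+1| = #|iter_ker n| * #|[set x in iter_im n | op x x == x]|.
Proof.
rewrite -card_iter_preim; last by apply/subsetP=> x; rewrite inE => /andP[].
by apply: eq_card => x; rewrite !inE /= T_eqO mem_iter_im.
Qed.

(* McKay's argument for Cauchy's theorem: rotating the triples (x, y, op x y)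
   needs no associativity, and fixes exactly the triples (x, x, x). *)
Lemma card_iter_im_mod n :
  #|[set x in iter_im n | op x x == x]| = #|iter_im n| ^ 2 %[mod 3].
Proof.
pose f (z : X * X) := (z.2, op z.1 z.2).
pose S := setX (iter_im n) (iter_im n).
have fS : {in S, forall z, f z \in S}.
  by move=> [x y] /setXP[Ix Iy]; rewrite in_setX Iy iter_im_op.
have f3 : iter 3 f =1 id.
  move=> [x y]; rewrite /f /= [op x y]opC opK [op y x]opC.
  by rewrite [op _ x]opC opK.
have := card_fixed_mod (isT : prime 3) f3 fS.
rewrite cardsX mulnn => ->; congr (_ %% 3).
have inj : injective (fun x : X => (x, x)) by move=> x y [].
rewrite -(card_imset _ inj); apply: eq_card => [[x y]].
rewrite !inE /f /= !xpair_eqE; apply/imsetP/idP => [[z + [-> ->]]|].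
  by rewrite !inE eqxx => /andP[-> ->].
move=> /andP[/andP[Ix Iy] /andP[/eqP yx]]; rewrite yx => exx.
by exists x => //; rewrite inE Ix.
Qed.

Lemma flex_iter_im_bound n :
  0 < #|[set x in iter_im n | op x x == x]| <= 3.
Proof.
rewrite -card_flex subset_leq_card ?andbT; last first.
  by apply/subsetP=> x; rewrite !inE => /andP[].
by rewrite (cardD1 O) !inE iter_imO opOO eqxx.
Qed.

(** For n < d the image still has size divisible by 3, so the congruence of [card_iter_im_mod] makes
    its number of flexes a multiple of 3. Lying between 1 and 3, that number is 3: the kernel
    triples and the image shrinks by 3. *)
Lemma card_iter_ker_im n : n <= d ->
  #|iter_ker n| = 3 ^ n /\ #|iter_im n| = 3 ^ (d - n) * N.
Proof.
elim: n => [_|n IH lt_nd]; last first.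
  have [ker_n im_n] := IH (ltnW lt_nd).
  have ker_n1 : #|iter_ker n.+1| = 3 ^ n.+1.
    rewrite card_iter_kerS ker_n expnSr; congr (_ * _).
    have dvd3 : 3 %| #|iter_im n| ^ 2.
      by rewrite im_n -(subnSK lt_nd) Euclid_dvdX // Euclid_dvdM // expnS dvdn_mulr.
    have := card_iter_im_mod n; have := flex_iter_im_bound n.
    rewrite (eqP dvd3).
    by case: #|_| => [|[|[|[|]]]].
  split=> //; have := card_iter_im n.+1; rewrite ker_n1 card_X.
  rewrite -(subnK lt_nd) addnC expnD -mulnA => /eqP.
  by rewrite eqn_pmul2l ?expn_gt0 // => /eqP ->; rewrite addKn.
have im0 : #|iter_im 0| = #|X|.
  by rewrite -cardsT; apply: eq_card => x; rewrite inE; apply/imsetP; exists x.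
rewrite subn0 expn0 im0 card_X; split=> //.
by apply/eqP/cards1P; exists O; apply/setP=> x; rewrite !inE.
Qed.

(** The analogue of the prime-to-3 part of the group, where [T] is invertible. *)
Definition core := iter_im d.

Lemma card_core : #|core| = N.
Proof. by rewrite (card_iter_ker_im (leqnn d)).2 subnn mul1n. Qed.

Lemma T_core x : x \in core -> T x \in core.
Proof. by case/imsetP=> z _ ->; rewrite -iterS iterSr mem_iter_im. Qed.

Lemma iter_core n x : x \in core -> iter n T x \in core.
Proof. by move=> Cx; elim: n => //= n; apply: T_core. Qed.

Lemma im_core n x : d <= n -> iter n T x \in core.
Proof.
by move=> /subnK <-; rewrite iterD iter_core ?mem_iter_im.
Qed.

(** The size N of the core is prime to 3, so N^2 = 1 mod 3 leaves a single flex in it. The kernel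
    then stops growing, and [T] maps the core onto a set of the same size. *)
Lemma T_core_inj : {in core &, injective T}.
Proof.
have c1 : #|[set x in core | op x x == x]| = 1.
  have := card_iter_im_mod d; have := flex_iter_im_bound d; rewrite -/core.
  rewrite card_core; move: coprime_N; rewrite prime_coprime // /dvdn -modnXm.
  by case: (N %% 3) (ltn_pmod N (isT : 0 < 3)) => [|[|[|//]]] //;
    case: #|_| => [|[|[|[|]]]].
apply/imset_injP; rewrite card_core.
have -> : [set T x | x in core] = iter_im d.+1.
  apply/setP=> y; apply/imsetP/imsetP => [[_ /imsetP[x _ ->] ->]|[x _ ->]].
    by exists x.
  by exists (iter d T x); rewrite ?mem_iter_im.
have := card_iter_im d.+1; rewrite card_iter_kerS c1 muln1 -(card_iter_im d).
move/eqP; rewrite eqn_pmul2l ?card_core; first by move=> /eqP ->.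
by rewrite (card_iter_ker_im (leqnn d)).1 expn_gt0.
Qed.

Lemma core_periodic x : x \in core -> exists2 n, 0 < n & iter n T x = x.
Proof.
move=> Cx.
exists (order T x); first exact: order_gt0.
exact: (@iter_order_in _ _ (mem core) T_core T_core_inj).
Qed.

(** The image of [T^(d - n)] is mapped into the core by [T^n], and both sets have 3^n N elements.
    This turns the distance to the periodic part into the number of times one can go backwards. *)
Lemma iter_coreP n x : n <= d -> (iter n T x \in core) = (x \in iter_im (d - n)).
Proof.
move=> le_nd.
suff -> : iter_im (d - n) = [set x | iter n T x \in core] by rewrite inE.
apply/eqP; rewrite eqEcard; apply/andP; split.
  apply/subsetP=> _ /imsetP[y _ ->].
  by rewrite inE -iterD subnKC // mem_iter_im.
have [kn _] := card_iter_ker_im le_nd.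
have [_ im] := card_iter_ker_im (leq_subr n d).
rewrite card_iter_preim ?kn ?card_core ?im ?subKn //.
apply/subsetP=> _ /imsetP[y _ ->].
by rewrite -(subnKC le_nd) iterD mem_iter_im.
Qed.

Lemma card_T_fiber x : #|[set z | T z == T x]| = 3.
Proof.
rewrite (card_iter_fiber 1 x) -card_flex; apply: eq_card => z.
by rewrite !inE T_eqO.
Qed.

End Descent.

(** * Trees of the functional graph *)

Section Trees.

Variable F : finFieldType.
Implicit Types (P Q R : P1 F) (n : nat).

Lemma depth_eq P Q n : iter n Hess Q = P ->
  (forall i, (i < n)%N -> iter i Hess Q != P) -> depth P Q = n.
Proof.
move=> nQ min_n; have QP : fconnect Hess Q P by rewrite -nQ fconnect_iter.
have [lt_n|lt_n|//] := ltngtP (depth P Q) n.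
  by have := min_n _ lt_n; rewrite iter_findex ?eqxx.
rewrite /depth -{1}nQ findex_iter //.
exact: ltn_trans lt_n (findex_max QP).
Qed.

Lemma iter_depth_neq P Q i : fconnect Hess Q P -> (i < depth P Q)%N ->
  iter i Hess Q != P.
Proof.
move=> QP lt_i; apply: contraTneq (lt_i) => iQ.
by rewrite -{1}iQ /depth findex_iter ?ltnn // (ltn_trans lt_i) ?findex_max.
Qed.

(** Membership in [tree P] with the depth as an explicit index, so that [nodeS] allows induction on
    it. *)
Definition node P n Q :=
  iter n Hess Q = P /\
  forall i, (i < n)%N -> iter i Hess Q != P /\ ~~ periodic (iter i Hess Q).

Lemma node_tree P n Q : node P n Q -> Q \in tree P /\ depth P Q = n.
Proof.
move=> [nQ hn]; have dQ : depth P Q = n by apply: depth_eq => // i /hn[].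
split=> //; rewrite inE -{1}nQ fconnect_iter dQ; apply/forallP=> i.
by case: (hn i (ltn_ord i)).
Qed.

Lemma tree_node P Q : Q \in tree P -> node P (depth P Q) Q.
Proof.
rewrite inE => /andP[QP /forallP h]; split=> [|i lt_i]; first exact: iter_findex.
by rewrite (iter_depth_neq QP lt_i) (h (Ordinal lt_i)).
Qed.

Lemma nodeS P n Q :
  node P n.+1 Q <-> [/\ node P n (Hess Q), Q != P & ~~ periodic Q].
Proof.
split=> [[nQ h]|[[nQ h] QP pQ]].
  have [? ?] := h 0%N isT; split=> //; split; first by rewrite -iterSr.
  by move=> i lt_i; rewrite -iterSr; apply: h.
split; first by rewrite iterSr.
by move=> [|i] lt_i //; rewrite iterSr; apply: h.
Qed.

Lemma root_tree P : P \in tree P.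
Proof. by have [] // := @node_tree P 0 P; split. Qed.

Lemma depth_root P : depth P P = 0%N.
Proof. exact: findex0. Qed.

Lemma tree_Hess P Q : Q \in tree P -> Q != P ->
  [/\ Hess Q \in tree P, depth P Q = (depth P (Hess Q)).+1 & ~~ periodic Q].
Proof.
move=> tQ QP; have := tree_node tQ.
case: (depth P Q) => [[] /= /eqP|n /nodeS[]]; first by rewrite (negPf QP).
by move=> /node_tree[-> ->].
Qed.

Lemma tree_preim P Q : Hess Q \in tree P -> Q != P -> ~~ periodic Q ->
  Q \in tree P.
Proof.
by move=> /tree_node h QP pQ; have [] := @node_tree P (depth P (Hess Q)).+1 Q;
  rewrite ?nodeS.
Qed.

Lemma tree_edgeP P Q R : reflect
  [/\ Q \in tree P, R \in tree P, Q != P & Hess Q = R] (tree_edge P Q R).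
Proof.
by apply: (iffP and4P) => -[-> -> ->]; [move=> /eqP|move=> ->; rewrite eqxx].
Qed.

(** * Isomorphisms between trees with the same arities *)

Definition children P R := enum [set Q | tree_edge P Q R].

(** Follows the path from the root: the i-th child of a node goes to the i-th child of the image of
    that node. *)
Fixpoint transfer P P' n Q :=
  if n is m.+1 then
    nth infty (children P' (transfer P P' m (Hess Q)))
        (index Q (children P (Hess Q)))
  else P'.

Lemma mem_children P Q R : (Q \in children P R) = tree_edge P Q R.
Proof. by rewrite mem_enum inE. Qed.

(** As arities depend only on the depth, the index of a child stays in range on the other side;
    enumerations have no repetition, so transferring back finds the same index. *)
Lemma transfer_node (c : nat -> nat) P P' n Q :
    (forall Q, Q \in tree P -> size (children P Q) = c (depth P Q)) ->
    (forall Q, Q \in tree P' -> size (children P' Q) = c (depth P' Q)) ->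
    node P n Q ->
  node P' n (transfer P P' n Q) /\ transfer P' P n (transfer P P' n Q) = Q.
Proof.
move=> cP cP'; elim: n Q => [Q [] /= ->|n IH Q /nodeS[nR QP pQ]] //.
have [nR' trR'] := IH _ nR.
have [tR dR] := node_tree nR; have [tR' dR'] := node_tree nR'.
have tQ : Q \in tree P by apply: tree_preim.
have QcR : Q \in children P (Hess Q) by rewrite mem_children; apply/tree_edgeP.
set R' := transfer P P' n (Hess Q) in nR' trR' tR' dR'.
have lt_i : (index Q (children P (Hess Q)) < size (children P' R'))%N.
  by rewrite cP' // dR' -dR -cP // index_mem.
have := mem_nth infty lt_i; rewrite mem_children => /tree_edgeP[].
rewrite /= -/R'; set Q' := nth _ _ _ => tQ' _ Q'P' hQ'.
have [_ _ pQ'] := tree_Hess tQ' Q'P'.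
split; first by apply/nodeS; rewrite hQ'.
by rewrite hQ' trR' index_uniq ?enum_uniq // nth_index.
Qed.

(* Spherically symmetric rooted trees are determined by their numbers of
   children at each depth. *)
Lemma tree_iso_regular (c : nat -> nat) P P' :
    (forall Q, Q \in tree P -> size (children P Q) = c (depth P Q)) ->
    (forall Q, Q \in tree P' -> size (children P' Q) = c (depth P' Q)) ->
  tree_iso P P'.
Proof.
move=> cP cP'; pose f Q := transfer P P' (depth P Q) Q.
pose g Q := transfer P' P (depth P' Q) Q.
have f_node Q : Q \in tree P -> node P' (depth P Q) (f Q) /\ g (f Q) = Q.
  move=> /tree_node nQ; have [nQ' trQ'] := transfer_node cP cP' nQ.
  by split=> //; rewrite /g (node_tree nQ').2.
have g_node Q : Q \in tree P' -> node P (depth P' Q) (g Q) /\ f (g Q) = Q.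
  move=> /tree_node nQ; have [nQ' trQ'] := transfer_node cP' cP nQ.
  by split=> //; rewrite /f (node_tree nQ').2.
have f_inj : {in tree P &, injective f}.
  by move=> Q R /f_node[_ gfQ] /f_node[_ gfR] fQR; rewrite -gfQ fQR gfR.
have f_tree Q : Q \in tree P -> f Q \in tree P'.
  by move=> /f_node[/node_tree[]].
have f_root : f P = P' by rewrite /f depth_root.
have f_Hess Q : Q \in tree P -> Q != P -> Hess (f Q) = f (Hess Q).
  move=> tQ QP; have [tHQ dQ pQ] := tree_Hess tQ QP.
  have [+ _] := f_node _ tQ; rewrite /f dQ => /nodeS[nHQ _ _].
  have [+ _] := f_node _ tHQ => nfHQ.
  rewrite /=; set s := children P' _; set i := index _ _.
  have lt_i : (i < size s)%N.
    rewrite cP' ?(node_tree nfHQ).1 // (node_tree nfHQ).2 -cP // index_mem.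
    by rewrite mem_children; apply/tree_edgeP.
  by have := mem_nth infty lt_i; rewrite mem_children => /tree_edgeP[].
exists f; split=> //.
  apply/setP=> Q; apply/imsetP/idP => [[R tR ->]|tQ]; first exact: f_tree.
  by have [nQ fgQ] := g_node _ tQ; exists (g Q); rewrite ?(node_tree nQ).1.
move=> Q R tQ tR; apply/tree_edgeP/tree_edgeP => -[_ _ QP hQ]; split=> //;
  rewrite ?f_tree //.
- by apply: contraNneq QP => ->; rewrite f_root.
- have QP' : Q != P by apply: contraNneq QP => ->; rewrite f_root.
  have [tHQ _ _] := tree_Hess tQ QP'.
  by apply: f_inj => //; rewrite -f_Hess.
- by apply: contraNneq QP => e; apply/eqP/f_inj; rewrite ?root_tree // e.
- by rewrite f_Hess // hQ.
Qed.

(** No preimage of a non-periodic node is lost: a periodic preimage would make [Q] periodic, and if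
    the root were a preimage, [Q] would lie on a cycle through it. *)
Lemma size_children P Q : Q \in tree P -> ~~ periodic Q ->
  size (children P Q) = indegree Q.
Proof.
move=> tQ pQ.
rewrite -cardE; apply: eq_card => R; rewrite !inE.
apply/tree_edgeP/eqP => [[]//|hR].
have pR : ~~ periodic R.
  apply: contra pQ => /periodicP[n n0 nR]; apply/periodicP; exists n => //.
  by rewrite -hR -iterSr iterS nR.
have RP : R != P.
  apply: contraNneq pR => RP; apply/periodicP.
  have [dQ _] := tree_node tQ; exists (depth P Q).+1 => //.
  by rewrite iterSr hR dQ RP.
by split=> //; apply: tree_preim; rewrite ?hR.
Qed.

(** * Periodic points and the branches at a root *)

Lemma periodic_Hess P : periodic P -> periodic (Hess P).
Proof.
move=> /periodicP[n n0 nP]; apply/periodicP; exists n => //.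
by rewrite -iterSr iterS nP.
Qed.

Lemma periodic_order P : periodic P -> iter (order Hess P) Hess P = P.
Proof.
move=> /periodicP[[//|n] _ nP].
(* The two clauses of [orbitPcycle] used here: some positive iterate fixes [P], and the iterate
   [order Hess P] fixes [P]. *)
by apply: (all_iffLR orbitPcycle 3 4); exists n.
Qed.

Lemma iter_fix n m P : iter n Hess P = P -> iter (n * m) Hess P = P.
Proof.
by move=> nP; elim: m => [|m IH]; rewrite ?muln0 // mulnS iterD IH.
Qed.

(** Both points are fixed by the iterate [n * m], a positive common period, and this iterate factors
    through [Hess]. *)
Lemma periodic_Hess_inj : {in @periodic F &, injective Hess}.
Proof.
move=> P Q /periodicP[n n0 nP] /periodicP[m m0 mQ] PQ.
rewrite -(iter_fix m nP) -(iter_fix n mQ) [(m * n)%N]mulnC.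
by rewrite -(prednK (_ : 0 < n * m)%N) ?muln_gt0 ?n0 // !iterSr PQ.
Qed.

Lemma periodic_preim P : periodic P -> exists2 Q, periodic Q & Hess Q = P.
Proof.
move=> /periodicP[[//|n] _ nP]; exists (iter n Hess P) => //.
by apply/periodicP; exists n.+1; rewrite // -iterD addnC iterD nP.
Qed.

Lemma tree_edge_root P R : periodic P ->
  tree_edge P R P = (Hess R == P) && ~~ periodic R.
Proof.
move=> pP; apply/tree_edgeP/andP => [[tR _ RP hR]|[/eqP hR pR]].
  by have [_ _ ->] := tree_Hess tR RP; rewrite hR.
have RP : R != P by apply: contraNneq pR => ->.
by split; rewrite ?root_tree // tree_preim // hR root_tree.
Qed.

Lemma size_root_branches P :
  size (root_branches P) = (\sum_(Q | tree_edge P Q P) mult P Q)%N.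
Proof.
rewrite size_flatten /shape -map_comp sumnE big_map big_filter big_enum_cond /=.
by apply: eq_big => [Q|Q _]; rewrite ?size_nseq.
Qed.

Lemma mem_root_branches P Q : Q \in root_branches P -> tree_edge P Q P.
Proof.
move=> /flattenP[s /mapP[R]]; rewrite mem_filter => /andP[eR _] ->.
by rewrite mem_nseq => /andP[_ /eqP->].
Qed.

Lemma node_branch P Q n R : periodic P -> tree_edge P Q P -> node Q n R ->
  node P n.+1 R.
Proof.
move=> pP; rewrite tree_edge_root // => /andP[/eqP hQ pQ] [nR h].
split=> [|i]; first by rewrite iterS nR.
rewrite ltnS leq_eqVlt => /orP[/eqP->|/h[_ piR]].
  by rewrite nR; split=> //; apply: contraNneq pQ => ->.
by split=> //; apply: contraNneq piR => ->.
Qed.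

End Trees.

(** * The curves y^2 = x^3 + B *)

Section Curve.

Local Open Scope ring_scope.

Variable F : finFieldType.
Hypothesis F_mod3 : #|F| = 2 %[mod 3].
Hypothesis nz2 : 2%:R != 0 :> F.
Hypothesis nz3 : 3%:R != 0 :> F.

Implicit Types (B x y z : F) (P Q R : option F).

(** * Cube roots in F, and -3 as a non-square *)

Lemma natr23_neq0 a b : (2 ^ a * 3 ^ b)%:R != 0 :> F.
Proof. by rewrite natrM !natrX mulf_neq0 ?expf_neq0. Qed.

(** With q = 3m + 2, the exponent 2m + 1 inverts 3 modulo q - 1, since 3(2m + 1) = 2(q - 1) + 1. *)
Definition cbrt (z : F) : F := z ^+ (2 * (#|F| %/ 3)).+1.

Lemma cbrtK (z : F) : cbrt z ^+ 3 = z.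
Proof.
have cF : #|F| = (#|F| %/ 3 * 3 + 2)%N by rewrite {1}(divn_eq #|F| 3) F_mod3.
rewrite -exprM; set m := (_ %/ _)%N in cF *.
have -> : ((2 * m).+1 * 3 = #|F| + #|F|.-1)%N by rewrite cF; lia.
rewrite exprD expf_card -{1}(expr1 z) -exprD add1n prednK ?expf_card //.
by rewrite cF addn2.
Qed.

Lemma expr3K : cancel (fun z : F => z ^+ 3) cbrt.
Proof. by move=> z; rewrite /cbrt exprAC cbrtK. Qed.

Lemma expr3_inj : injective (fun z : F => z ^+ 3).
Proof. exact: can_inj expr3K. Qed.

(** A square root [s] of -3 would give the cube root of unity (-1 + s)/2. Injectivity of cubing
    forces it to be 1, so s = 3 and 12 = 0. *)
Lemma nonsquareN3 (s : F) : s ^+ 2 != - 3%:R.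
Proof.
apply/eqP => s2.
have h : ((-1 + s) / 2%:R) ^+ 3 = 1 ^+ 3.
  have -> : ((-1 + s) / 2%:R) ^+ 3 =
    (-1 + 3%:R * s - 3%:R * s ^+ 2 + s ^+ 2 * s) / 2%:R ^+ 3.
    by field; rewrite nz2 (natr23_neq0 3 0).
  rewrite s2; field; exact: (natr23_neq0 3 0).
have {h} s3 : s = 3%:R.
  have /eqP := expr3_inj h; rewrite -subr_eq0 => /eqP e.
  have -> : s = 3%:R + 2%:R * ((-1 + s) / 2%:R - 1) by field; rewrite nz2.
  by rewrite e mulr0 addr0.
have /eqP : (3%:R * 2%:R ^+ 2 : F) = 0.
  have -> : (3%:R * 2%:R ^+ 2 : F) = s ^+ 2 + 3%:R by rewrite s3; ring.
  by rewrite s2 addNr.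
by rewrite mulf_eq0 expf_eq0 (negPf nz2) (negPf nz3).
Qed.

(* An affine point (x, y) of the curve y^2 = x^3 + B is encoded by its
   ordinate y, since cubing is bijective; None is the point at infinity. *)
Definition absc (B y : F) : F := cbrt (y ^+ 2 - B).

Lemma absc3 B y : absc B y ^+ 3 = y ^+ 2 - B.
Proof. exact: cbrtK. Qed.

Lemma abscP B x y : x ^+ 3 = y ^+ 2 - B -> absc B y = x.
Proof. by rewrite /absc => <-; apply: expr3K. Qed.

Lemma abscN B y : absc B (- y) = absc B y.
Proof. by rewrite /absc sqrrN. Qed.

Lemma absc_eq0 B y : (absc B y == 0) = (y ^+ 2 == B).
Proof. by rewrite -[RHS]subr_eq0 -absc3 [RHS]expf_eq0. Qed.

Lemma absc_eq B y z : (absc B y == absc B z) = (y == z) || (y == - z).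
Proof.
rewrite -eqf_sqr; apply/eqP/eqP => [|yz]; last by rewrite /absc yz.
by move=> /(congr1 (fun u => u ^+ 3)); rewrite !absc3 => /addIr.
Qed.

(* The three points are the intersection of the curve with a line, counted
   with multiplicity: for the line y = l x + v, the last three equations are
   Vieta's formulas for x^3 + B - (l x + v)^2. *)
Definition collinear (B : F) (P Q R : option F) : Prop :=
  match P, Q, R with
  | Some y1, Some y2, Some y3 =>
      let: (x1, x2, x3) := (absc B y1, absc B y2, absc B y3) in
      exists l v : F,
      [/\ y1 = l * x1 + v, y2 = l * x2 + v, y3 = l * x3 + v
        & [/\ x1 + x2 + x3 = l ^+ 2, x1 * x2 + x1 * x3 + x2 * x3 = - (2%:R * l * v)
            & x1 * x2 * x3 = v ^+ 2 - B]]
  | Some y, Some z, None | Some y, None, Some z | None, Some y, Some z => y = - z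
  | None, None, None => True
  | _, _, _ => False
  end.

Lemma collinear_swap12 B P Q R : collinear B P Q R -> collinear B Q P R.
Proof.
case: P Q R => [y1|] [y2|] [y3|] //=; try by move->; rewrite opprK.
move=> [l [v [h1 h2 h3 [e1 e2 e3]]]]; exists l, v; split=> //.
by split; rewrite -?e1 -?e2 -?e3; ring.
Qed.

Lemma collinear_swap23 B P Q R : collinear B P Q R -> collinear B P R Q.
Proof.
case: P Q R => [y1|] [y2|] [y3|] //=; try by move->; rewrite opprK.
move=> [l [v [h1 h2 h3 [e1 e2 e3]]]]; exists l, v; split=> //.
by split; rewrite -?e1 -?e2 -?e3; ring.
Qed.

(** Vieta's formulas with the double root x amount to the tangency condition 3x^2 = 2ly. Here y = 0
    would force x = 0 and then B = 0. *)
Lemma tangent_slope (B y x3 l v : F) : B != 0 -> let x := absc B y in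
    y = l * x + v -> x + x + x3 = l ^+ 2 ->
    x * x + x * x3 + x * x3 = - (2%:R * l * v) ->
  y != 0 /\ l = 3%:R * x ^+ 2 / (2%:R * y).
Proof.
move=> B0 x yE e1 e2.
have sl : 3%:R * x ^+ 2 = l * (2%:R * y).
  have x3E : x3 = l ^+ 2 - x - x by rewrite -e1; ring.
  apply/eqP; rewrite -subr_eq0; apply/eqP.
  transitivity (- (x * x + x * x3 + x * x3) - (2%:R * l * v)).
    by rewrite x3E yE; ring.
  by rewrite e2; ring.
have y0 : y != 0.
  apply/eqP=> y0; move: sl; rewrite y0 !mulr0 => /eqP.
  rewrite mulf_eq0 (negPf nz3) expf_eq0 /= absc_eq0 y0 expr0n /= eq_sym.
  by rewrite (negPf B0).
by split=> //; rewrite sl mulfK // mulf_neq0.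
Qed.

(** The first two points determine the slope, as a chord or as a tangent, and the sum of the
    abscissas then gives the third. By [vertical], opposite points lie on no line of the form y = l
    x + v that meets the curve in three affine points. *)
Lemma collinear_uniq B P Q R R' : B != 0 ->
  collinear B P Q R -> collinear B P Q R' -> R = R'.
Proof.
move=> B0.
have vertical (y1 y2 y3 : F) : y1 = - y2 ->
    ~ collinear B (Some y1) (Some y2) (Some y3).
  move=> y12 [l [v [h1 h2 _ [e1 e2 _]]]].
  have x12 : absc B y2 = absc B y1 by rewrite y12 abscN.
  have y12' : y2 = y1 by rewrite h1 -x12.
  rewrite x12 in e1 e2.
  have [/negP[]] := tangent_slope B0 h1 e1 e2.
  have : y1 * 2%:R == 0 by rewrite mulr_natr mulr2n {1}y12 y12' addNr.
  by rewrite mulf_eq0 (negPf nz2) orbF.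
case: P Q R R' => [y1|] [y2|] [y3|] [y4|] //=.
- move=> [l [v [h1 h2 h3 [e1 e2 e3]]]] [m [w [k1 k2 k4 [f1 f2 f3]]]].
  suff lm : l = m.
    have vw : v = w by apply: (addrI (l * absc B y1)); rewrite -h1 {1}k1 lm.
    congr Some; rewrite h3 k4 lm vw; congr (_ * _ + _).
    by apply: (addrI (absc B y1 + absc B y2)); rewrite e1 f1 lm.
  have [x12|x12] := eqVneq (absc B y1) (absc B y2).
    rewrite -x12 in e1 e2 f1 f2.
    have [_ ->] := tangent_slope B0 h1 e1 e2.
    by have [_ ->] := tangent_slope B0 k1 f1 f2.
  have x12' : absc B y1 - absc B y2 != 0 by rewrite subr_eq0.
  apply: (mulIf x12'); transitivity (y1 - y2).
    by rewrite {2}h1 {2}h2; ring.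
  by rewrite {1}k1 {1}k2; ring.
- by move=> h y12; case: (vertical _ _ _ y12 h).
- by move=> y12 h; case: (vertical _ _ _ y12 h).
- by move=> -> /oppr_inj ->.
- by move=> -> /oppr_inj ->.
Qed.

(** The chord and tangent formulas. If y1 is neither y2 nor -y2, the abscissas differ by [absc_eq];
    for y1 = -y2 the value of [l] is discarded. *)
Definition third (B : F) (P Q : option F) : option F :=
  match P, Q with
  | None, None => None
  | Some y, None | None, Some y => Some (- y)
  | Some y1, Some y2 =>
      let: (x1, x2) := (absc B y1, absc B y2) in
      let l := if y1 == y2 then 3%:R * x1 ^+ 2 / (2%:R * y1)
               else (y1 - y2) / (x1 - x2) in
      if y1 == - y2 then None else Some (l * (l ^+ 2 - x1 - x2) + (y1 - l * x1))
  end.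

Lemma eqNr_self (y : F) : (y == - y) = (y == 0).
Proof.
by rewrite -addr_eq0 -mulr2n -mulr_natr mulf_eq0 (negPf nz2) orbF.
Qed.

Lemma collinear_third B P Q : collinear B P Q (third B P Q).
Proof.
case: P Q => [y1|] [y2|] //=; rewrite ?opprK //.
have [//|y12] := eqVneq y1 (- y2); move: (erefl (absc B y1)) (erefl (absc B y2)).
move: {2 4}(absc B y1) {2 4}(absc B y2) => x1 x2 ex1 ex2; rewrite ex1 ex2.
set l := if _ then _ else _; pose v := y1 - l * x1; pose x3 := l ^+ 2 - x1 - x2.
have c1 : x1 ^+ 3 = y1 ^+ 2 - B by rewrite -ex1 absc3.
have c2 : x2 ^+ 3 = y2 ^+ 2 - B by rewrite -ex2 absc3.
have h1 : y1 = l * x1 + v by rewrite /v; ring.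
have [h2 e2] : y2 = l * x2 + v /\ x1 * x2 + x1 * x3 + x2 * x3 = - (2%:R * l * v).
  have [y12'|y12'] := eqVneq y1 y2.
    have x12 : x2 = x1 by rewrite -ex1 -ex2 y12'.
    have y10 : y1 != 0 by rewrite -eqNr_self {2}y12'.
    split; first by rewrite x12 -h1 y12'.
    by rewrite /v /x3 x12 /l y12' eqxx -y12'; field; rewrite y10 nz2.
  have x12 : x1 - x2 != 0
    by rewrite subr_eq0 -ex1 -ex2 absc_eq (negPf y12') (negPf y12).
  have lE : l * (x1 - x2) = y1 - y2 by rewrite /l (negPf y12') divfK.
  have h2 : y2 = l * x2 + v.
    rewrite /v; transitivity (y1 - l * (x1 - x2)); last by ring.
    by rewrite lE; ring.
  split=> //; apply: (mulIf x12); apply/eqP; rewrite -subr_eq0; apply/eqP.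
  transitivity ((y1 ^+ 2 - B - x1 ^+ 3) - (y2 ^+ 2 - B - x2 ^+ 3)).
    by rewrite /x3 h1 h2; ring.
  by rewrite c1 c2; ring.
have e3 : x1 * x2 * x3 = v ^+ 2 - B.
  transitivity (x1 * (x1 * x2 + x1 * x3 + x2 * x3) + x1 ^+ 3 - l ^+ 2 * x1 ^+ 2).
    by rewrite /x3; ring.
  by rewrite e2 c1 h1; ring.
have ex3 : absc B (l * x3 + v) = x3.
  apply: abscP; transitivity (x1 * x2 * x3 - x3 * (x1 * x2 + x1 * x3 + x2 * x3)
      + l ^+ 2 * x3 ^+ 2).
    by rewrite /x3; ring.
  by rewrite e3 e2; ring.
exists l, v; rewrite ex3; split=> //; split=> //.
by rewrite /x3; ring.
Qed.

Lemma thirdC B P Q : B != 0 -> third B P Q = third B Q P.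
Proof.
move=> B0; apply: (@collinear_uniq B P Q) => //; first exact: collinear_third.
exact/collinear_swap12/collinear_third.
Qed.

Lemma thirdK B P Q : B != 0 -> third B P (third B P Q) = Q.
Proof.
move=> B0; apply: (@collinear_uniq B P (third B P Q)) => //.
  exact: collinear_third.
exact/collinear_swap23/collinear_third.
Qed.

Lemma third_flex B P : B != 0 -> ~~ [exists y : F, y ^+ 2 == B] ->
  (third B P P == P) =
  if P is Some y then absc B y ^+ 3 == - (4%:R * B) else true.
Proof.
move=> B0 /existsPn nB; case: P => [y|] //=; rewrite eqxx eqNr_self absc3.
set x := absc B y.
have x0 : x != 0 by rewrite /x absc_eq0 nB.
have [->|y0] := eqVneq y 0.
  rewrite expr0n /= sub0r eqr_opp [RHS]eq_sym -[RHS]subr_eq0.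
  have -> : 4%:R * B - B = 3%:R * B by ring.
  by rewrite mulf_eq0 (negPf nz3) (negPf B0).
have cx : x ^+ 3 = y ^+ 2 - B by rewrite absc3.
rewrite -cx; apply/eqP/eqP => [[] | e].
  set l := 3%:R * _ / _ => h.
  have sl : l * (2%:R * y) = 3%:R * x ^+ 2 by rewrite divfK // mulf_neq0.
  clearbody l.
  have l0 : l != 0.
    apply: contraNneq x0 => l0; move/eqP: sl.
    by rewrite l0 mul0r eq_sym mulf_eq0 (negPf nz3) expf_eq0.
  have {h} h : l ^+ 2 = 3%:R * x.
    apply: (mulfI l0); apply/eqP; rewrite -subr_eq0; apply/eqP.
    transitivity (l * (l ^+ 2 - x - x) + (y - l * x) - y); first by ring.
    by rewrite h subrr.
  have : 3%:R * x * (x ^+ 3 + 4%:R * B) == 0.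
    transitivity ((3%:R * x) * (4%:R * (y ^+ 2)) == (3%:R * x ^+ 2) ^+ 2).
      rewrite -[RHS]subr_eq0.
      have -> : y ^+ 2 = x ^+ 3 + B by rewrite cx subrK.
      by congr (_ == 0); ring.
    by rewrite -h -sl; apply/eqP; ring.
  rewrite !mulf_eq0 (negPf nz3) (negPf x0) /= => /eqP e.
  by apply/eqP; rewrite -subr_eq0 opprK e.
congr Some; apply: (addIr (- y)); rewrite subrr.
set l := 3%:R * _ / _.
have sl : l * (2%:R * y) = 3%:R * x ^+ 2 by rewrite divfK // mulf_neq0.
clearbody l.
have h : l ^+ 2 = 3%:R * x.
  have z : (2%:R * y) ^+ 2 != 0 by rewrite expf_neq0 // mulf_neq0.
  apply: (mulIf z); rewrite -exprMn sl; apply/eqP; rewrite -subr_eq0; apply/eqP.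
  transitivity (9%:R * x * x ^+ 3 - 12%:R * x * y ^+ 2); first by ring.
  have -> : y ^+ 2 = x ^+ 3 + B by rewrite cx subrK.
  by rewrite e; ring.
transitivity (l * (l ^+ 2 - 3%:R * x)); first by ring.
by rewrite h subrr mulr0.
Qed.

(* The quotient by the subgroup x = 0 of order 3, followed by a scaling. *)
Definition isog (B c : F) (P : option F) : option F :=
  if P is Some y then
    if y ^+ 2 == B then None
    else Some (y * (y ^+ 2 - 9%:R * B) / (c ^+ 3 * (y ^+ 2 - B)))
  else None.

Section Isogeny.

Variables B B' c : F.
Hypothesis B0 : B != 0.
Hypothesis c0 : c != 0.
(** The quotient is y^2 = x^3 - 27B, and (X, Y) -> (X/c^2, Y/c^3) takes it to y^2 = x^3 + B'. *)
Hypothesis BB' : c ^+ 6 * B' = - (27%:R * B).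

Lemma isog_ord (y : F) : y ^+ 2 != B -> let x := absc B y in
  isog B c (Some y) = Some (y * (x ^+ 3 - 8%:R * B) / (c * x) ^+ 3).
Proof.
move=> yB x; rewrite /= (negPf yB) exprMn absc3; congr (Some (_ * _ / _)).
by ring.
Qed.

(** Vélu's formula for the abscissa; since cube roots are unique, it is enough to check that its
    cube satisfies the equation of the target curve. *)
Lemma isog_absc (y z : F) : y ^+ 2 != B -> isog B c (Some y) = Some z ->
  let x := absc B y in absc B' z = (x ^+ 3 + 4%:R * B) / (c * x) ^+ 2.
Proof.
move=> yB; rewrite isog_ord // => -[<-] x.
have x0 : x != 0 by rewrite /x absc_eq0.
have B'E : B' = - (27%:R * B) / c ^+ 6 by rewrite -BB' [_ * B']mulrC mulfK ?expf_neq0.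
apply: abscP; rewrite B'E exprMn expr_div_n [(y * _) ^+ 2]exprMn.
have -> : y ^+ 2 = x ^+ 3 + B by rewrite absc3 subrK.
by rewrite -/x; clearbody x; field; rewrite c0 x0.
Qed.

(** Points with x = 0 go to infinity; on a line through one of them the other two points have
    opposite images ([kernel]). In the remaining affine case the image line is written down
    explicitly. *)
Lemma collinear_isog P Q R : collinear B P Q R ->
  collinear B' (isog B c P) (isog B c Q) (isog B c R).
Proof.
have vertical y : collinear B' None (isog B c (Some y)) (isog B c (Some (- y))).
  by rewrite /= sqrrN; case: ifP => //= _; rewrite !mulNr opprK.
have kernel (y1 y2 y3 : F) : absc B y1 = 0 ->
    collinear B (Some y1) (Some y2) (Some y3) ->
    collinear B' None (isog B c (Some y2)) (isog B c (Some y3)).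
  move=> x1 [l [v [_ h2 h3 [e1 e2 e3]]]].
  rewrite x1 ?mul0r ?add0r in e1 e2 e3.
  have vB : v ^+ 2 = B by apply/eqP; rewrite -subr_eq0 -e3.
  have v0 : v != 0 by apply: contraNneq B0 => v0; rewrite -vB v0 expr0n.
  have [x2|x2] := eqVneq (absc B y2) 0.
    move/eqP: e2; rewrite x2 mul0r eq_sym oppr_eq0 !mulf_eq0 (negPf nz2) /=.
    rewrite (negPf v0) orbF => /eqP l0.
    move/eqP: e1; rewrite x2 add0r l0 expr0n /= => x3.
    by move: x2 x3 => /eqP; rewrite !absc_eq0 => -> ->.
  have [x3|x3] := eqVneq (absc B y3) 0.
    move/eqP: e2; rewrite x3 mulr0 eq_sym oppr_eq0 !mulf_eq0 (negPf nz2) /=.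
    rewrite (negPf v0) orbF => /eqP l0.
    by move/eqP: e1; rewrite x3 addr0 l0 expr0n /= (negPf x2).
  have n2 : y2 ^+ 2 != B by rewrite -absc_eq0.
  have n3 : y3 ^+ 2 != B by rewrite -absc_eq0.
  rewrite !isog_ord //=; move: x2 x3 h2 h3 e1 e2.
  move: (absc B y2) (absc B y3) => x2 x3 nx2 nx3 h2 h3 e1 e2.
  have l0 : l != 0.
    apply: contraNneq nx2 => l0; move/eqP: e2.
    by rewrite l0 mulr0 mul0r oppr0 mulf_eq0 (negPf nx3) orbF.
  have vE : v = - (x2 * x3) / (2%:R * l).
    by rewrite e2 opprK mulrC mulKf // mulf_neq0.
  have x3E : x3 = l ^+ 2 - x2 by rewrite -e1 addrC addKr.
  rewrite h2 h3 -vB vE.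
  rewrite x3E in nx3 *.
  by field; rewrite nz2 c0 l0 nx2 nx3.
case: P Q R => [y1|] [y2|] [y3|] //.
- move=> h.
  have [/eqP x1|x1] := boolP (absc B y1 == 0).
    have := kernel _ _ _ x1 h; congr (collinear _ _ _ _).
    by move/eqP: x1; rewrite absc_eq0 /= => ->.
  have [/eqP x2|x2] := boolP (absc B y2 == 0).
    have := kernel _ _ _ x2 (collinear_swap12 h) => /collinear_swap12.
    congr (collinear _ _ _ _).
    by move/eqP: x2; rewrite absc_eq0 /= => ->.
  have [/eqP x3|x3] := boolP (absc B y3 == 0).
    have := kernel _ _ _ x3 (collinear_swap12 (collinear_swap23 h)).
    move=> /collinear_swap12/collinear_swap23.
    congr (collinear _ _ _ _).
    by move/eqP: x3; rewrite absc_eq0 /= => ->.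
  have n1 : y1 ^+ 2 != B by rewrite -absc_eq0.
  have n2 : y2 ^+ 2 != B by rewrite -absc_eq0.
  have n3 : y3 ^+ 2 != B by rewrite -absc_eq0.
  have [z1 ez1] : exists z, isog B c (Some y1) = Some z.
    by rewrite isog_ord //; eexists.
  have [z2 ez2] : exists z, isog B c (Some y2) = Some z.
    by rewrite isog_ord //; eexists.
  have [z3 ez3] : exists z, isog B c (Some y3) = Some z.
    by rewrite isog_ord //; eexists.
  rewrite ez1 ez2 ez3 /= (isog_absc n1 ez1) (isog_absc n2 ez2) (isog_absc n3 ez3).
  move: ez1 ez2 ez3; rewrite !isog_ord // => -[<-] [<-] [<-].
  move: h => [l [v [h1 h2 h3 h]]]; move: x1 x2 x3 h1 h2 h3 h.
  move: (absc B y1) (absc B y2) (absc B y3).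
  move=> x1 x2 x3 nx1 nx2 nx3 -> -> -> [e1 e2 e3].
  (* On a horizontal line all abscissas have the same cube, hence coincide, and Vieta then gives
     3x^2 = 0. *)
  have l0 : l != 0.
    apply/eqP => l0; rewrite l0 in e1 e2 e3.
    have x3E : x3 = - (x1 + x2).
      by apply/eqP; rewrite -addr_eq0 addrC e1 expr0n.
    have h : (x1 - x2) * (x1 ^+ 2 + x1 * x2 + x2 ^+ 2) = 0.
      transitivity (- (x1 - x2) * (x1 * x2 + x1 * x3 + x2 * x3)).
        by rewrite x3E; ring.
      by rewrite e2 mulr0 mul0r oppr0 mulr0.
    have x12 : x1 = x2.
      apply: expr3_inj; apply/eqP; rewrite -subr_eq0; apply/eqP.
      by rewrite -[RHS]h; ring.
    move/eqP: e2; rewrite x3E x12 mulr0 mul0r oppr0.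
    have -> : x2 * x2 + x2 * - (x2 + x2) + x2 * - (x2 + x2) = - (3%:R * x2 ^+ 2).
      by ring.
    by rewrite oppr_eq0 mulf_eq0 (negPf nz3) expf_eq0 (negPf nx2).
  have B'E : B' = - (27%:R * B) / c ^+ 6 by rewrite -BB' [_ * B']mulrC mulfK ?expf_neq0.
  (* Vieta's formulas eliminate [B], [v] and [x3] in favor of [l], [x1] and [x2], so that only
     identities of rational functions remain. *)
  have BE : B = v ^+ 2 - x1 * x2 * x3 by rewrite e3; ring.
  have vE : v = - (x1 * x2 + x1 * x3 + x2 * x3) / (2%:R * l).
    by rewrite e2 opprK [_ * l * v]mulrC mulfK // mulf_neq0.
  have x3E : x3 = l ^+ 2 - x1 - x2 by rewrite -e1; ring.
  (* Slope and intercept of the image line; the denominators contain x1 x2 x3 = v^2 - B. *)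
  exists (l * (v ^+ 2 + 3%:R * B) / (c * (x1 * x2 * x3))).
  exists ((v * (v ^+ 2 - 9%:R * B) - 4%:R * l ^+ 3 * B) / (c ^+ 3 * (x1 * x2 * x3))).
  rewrite B'E BE vE; rewrite x3E in nx3 *.
  split; last split; by field; rewrite ?nz2 ?c0 ?l0 ?nx1 ?nx2 ?nx3.
- move=> y12; have -> : y1 = - y2 by exact: y12.
  exact/collinear_swap23/collinear_swap12/collinear_swap23.
- move=> y13; have -> : y1 = - y3 by exact: y13.
  exact/collinear_swap12/collinear_swap23.
- move=> y23; have -> : y2 = - y3 by exact: y23.
  exact/collinear_swap23.
Qed.

End Isogeny.
(** * The Hessian graph as a quotient *)

Definition curveN27 : F := - 27%:R.
(** The scalings 3 and 1 close the loop between B = -27 and B = 1: 3^6 = (-27)(-27) for [alpha], and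
    -27 = -27 * 1 for [beta]. *)
Definition alpha := isog curveN27 3%:R.
Definition beta := isog 1 1.
Definition dual_step P := beta (alpha P).

Lemma curveN27_neq0 : curveN27 != 0.
Proof. by rewrite oppr_eq0 (natr23_neq0 0 3). Qed.

Lemma sqr_neq_curveN27 y : y ^+ 2 != curveN27.
Proof.
apply: contraNneq (nonsquareN3 (y / 3%:R)) => e.
rewrite expr_div_n e /curveN27; apply/eqP; field; exact: (natr23_neq0 0 2).
Qed.

Lemma alpha_Some y : exists z, alpha (Some y) = Some z.
Proof. by rewrite /alpha /= (negPf (sqr_neq_curveN27 y)); eexists. Qed.

Lemma collinear_alpha P Q R :
  collinear curveN27 P Q R -> collinear 1 (alpha P) (alpha Q) (alpha R).
Proof.
by apply: collinear_isog; rewrite ?curveN27_neq0 //; rewrite /curveN27; ring.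
Qed.

Lemma collinear_beta P Q R :
  collinear 1 P Q R -> collinear curveN27 (beta P) (beta Q) (beta R).
Proof.
by apply: collinear_isog; rewrite ?oner_neq0 //; rewrite /curveN27; ring.
Qed.

Lemma isogN_omap B c P : isog B c (omap -%R P) = omap -%R (isog B c P).
Proof.
by case: P => [y|] //=; rewrite sqrrN; case: ifP => //= _; rewrite !mulNr.
Qed.

Lemma collinear_omapN B P : collinear B P (omap -%R P) None.
Proof. by case: P => [y|] //=; rewrite opprK. Qed.

(** If [P] and [Q] have the same image, the third point of [P] and [-Q] goes to infinity. No affine
    point does, as -27 is not a square, so [P] and [-Q] are opposite. *)
Lemma alpha_inj : injective alpha.
Proof.
move=> P Q PQ; have := collinear_third curveN27 P (omap -%R Q).
set R := third _ _ _ => PQR; have := collinear_alpha PQR.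
rewrite {2}/alpha isogN_omap -/(alpha Q) -PQ => h.
have := collinear_uniq (oner_neq0 F) h (collinear_omapN 1 (alpha P)).
case: R PQR h => [z|] PQR _; first by have [t ->] := alpha_Some z.
move=> _; case: P Q PQR {PQ} => [y|] [z|] //= ->.
by rewrite opprK.
Qed.

Lemma alpha_bij : bijective alpha.
Proof. exact: injF_bij alpha_inj. Qed.

Lemma dual_step_third :
  {morph dual_step : P Q / third curveN27 P Q}.
Proof.
move=> P Q; apply: (@collinear_uniq curveN27 (dual_step P) (dual_step Q)).
- exact: curveN27_neq0.
- exact/collinear_beta/collinear_alpha/collinear_third.
- exact: collinear_third.
Qed.

(** [beta] kills exactly infinity and the points with x = 0, and the abscissa of [alpha P] vanishes
    iff x^3 + 4B = 0, the flex condition. *)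
Lemma dual_step_eq_None P :
  (dual_step P == None) = (third curveN27 P P == P).
Proof.
rewrite third_flex ?curveN27_neq0 //; last first.
  by apply/existsPn => y; apply: sqr_neq_curveN27.
case: P => [y|] //; rewrite /dual_step.
have [z zE] := alpha_Some y; rewrite zE /=.
have -> : ((if z ^+ 2 == 1 then None else
    Some (z * (z ^+ 2 - 9%:R * 1) / (1 ^+ 3 * (z ^+ 2 - 1)))) == None) = (z ^+ 2 == 1).
  by case: ifP.
have BB' : 3%:R ^+ 6 * 1 = - (27%:R * curveN27) :> F by rewrite /curveN27; ring.
rewrite -absc_eq0 (isog_absc nz3 BB' (sqr_neq_curveN27 y) zE).
rewrite mulf_eq0 invr_eq0 expf_eq0 /= mulf_eq0 (negPf nz3) absc_eq0.
by rewrite (negPf (sqr_neq_curveN27 y)) !orbF addr_eq0.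
Qed.

Lemma card_third_flex :
  #|[set P : option F | third curveN27 P P == P]| = 3%N.
Proof.
(* For B = -27 the affine flexes have x^3 = 108, so y^2 = 81. *)
have -> : [set P | third curveN27 P P == P] =
    [set None; Some 9%:R; Some (- 9%:R)].
  apply/setP => P; rewrite !inE third_flex ?curveN27_neq0 //; last first.
    by apply/existsPn => y; apply: sqr_neq_curveN27.
  case: P => [y|] //=; rewrite absc3 -eqf_sqr -[LHS]subr_eq0 -[RHS]subr_eq0.
  by congr (_ == 0); rewrite /curveN27; ring.
rewrite setUC cardsU1 cards2 !inE /= (inj_eq Some_inj) eq_sym eqNr_self.
by rewrite (negPf (natr23_neq0 0 2)).
Qed.

(* With B = -27 resp. B = 1 this is j = -1728 x^3 / B, written in terms of y. *)
Definition piX P : P1 F :=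
  if P is Some y then Some (4%:R ^+ 3 * (y ^+ 2 + 27%:R)) else None.
Definition piY P : P1 F :=
  if P is Some y then Some (12%:R ^+ 3 * (1 - y ^+ 2)) else None.

Definition j1728 : P1 F := piX (Some 0).

Lemma natr1728 : 1728%:R = 12%:R ^+ 3 :> F.
Proof. by rewrite -natrX. Qed.

Lemma natr6912 : (4 * 1728)%:R = 4%:R * 12%:R ^+ 3 :> F.
Proof. by rewrite natrM natr1728. Qed.

Lemma cube12 : 12%:R ^+ 3 = 27%:R * 4%:R ^+ 3 :> F.
Proof. by ring. Qed.

Lemma HessE P : Hess P = if P is Some j then
  if j == 0 then None
  else Some (- (j - 4%:R * 12%:R ^+ 3) ^+ 3 / (27%:R * j ^+ 2)) else None.
Proof.
case: P => [j|]; rewrite /Hess /homog /=; last by rewrite mulr0 oppr0 eqxx.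
rewrite !mulr1 oppr_eq0 mulf_eq0 expf_eq0 (negPf (natr23_neq0 0 3)) /= natr6912.
by case: eqP => // _; rewrite invrN mulrN mulNr.
Qed.

(** Together with [Hess_piY] this exhibits [Hess] as the map induced by the two isogenies: two steps
    on the j-line are one step of [dual_step]. *)
Lemma Hess_piX P : Hess (piX P) = piY (alpha P).
Proof.
case: P => [y|] /=; last by rewrite HessE.
have y27 : y ^+ 2 + 27%:R != 0 by rewrite addr_eq0 sqr_neq_curveN27.
rewrite /alpha /= (negPf (sqr_neq_curveN27 y)) /= HessE.
rewrite mulf_eq0 (negPf y27) expf_eq0 (negPf (natr23_neq0 2 0)) /=.
congr Some; rewrite cube12 -/curveN27.
have := natr23_neq0 6 0; rewrite -[(_ * _)%:R]/(64%:R) (natrX _ 4 3).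
move: (4%:R ^+ 3) => m m0.
transitivity (- m * (y ^+ 2 - 81%:R) ^+ 3 / (27%:R * (y ^+ 2 + 27%:R) ^+ 2)).
  have -> : 81%:R = 4%:R * 27%:R - 27%:R :> F by ring.
  by move: 27%:R y27 (natr23_neq0 0 3) => e y27 e0; field; rewrite y27 e0 m0.
rewrite -[RHS]mulrA [27%:R * (m * _)]mulrCA -mulrA mulNr -mulrN; congr (_ * _).
by rewrite /curveN27; field; rewrite y27 (natr23_neq0 0 3).
Qed.

Lemma Hess_piY P : Hess (piY P) = piX (beta P).
Proof.
case: P => [y|] /=; last by rewrite HessE.
rewrite HessE mulf_eq0 expf_eq0 (negPf (natr23_neq0 2 1)) /=.
rewrite subr_eq0 eq_sym; have [//|y1] := eqVneq (y ^+ 2) 1.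
have y1' : 1 - y ^+ 2 != 0 by rewrite subr_eq0 eq_sym.
have y1'' : y ^+ 2 - 1 != 0 by rewrite subr_eq0.
congr Some; rewrite cube12.
have := natr23_neq0 6 0; rewrite -[(_ * _)%:R]/(64%:R) (natrX _ 4 3).
move: (4%:R ^+ 3) => m m0.
transitivity (m * ((3%:R + y ^+ 2) ^+ 3 / (1 - y ^+ 2) ^+ 2)).
  by move: 27%:R (natr23_neq0 0 3) => e e0; field; rewrite y1' e0 m0.
by congr (_ * _); field; rewrite y1'' y1'.
Qed.
Lemma cube4_neq0 : 4%:R ^+ 3 != 0 :> F.
Proof. by rewrite expf_neq0 // (natr23_neq0 2 0). Qed.

Lemma cube12_neq0 : 12%:R ^+ 3 != 0 :> F.
Proof. by rewrite expf_neq0 // (natr23_neq0 2 1). Qed.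

Definition two_torsion P := (P == None) || (P == Some 0).
Definition special (Q : P1 F) := (Q == infty) || (Q == j1728).

Lemma eq_omapN P : (P == omap -%R P) = two_torsion P.
Proof. by case: P => [y|] //=; rewrite (inj_eq Some_inj) eqNr_self. Qed.

Lemma two_torsionN P : two_torsion (omap -%R P) = two_torsion P.
Proof.
by case: P => [y|] //; rewrite /two_torsion /= !(inj_eq Some_inj) oppr_eq0.
Qed.

Lemma omapNK : involutive (omap -%R : option F -> option F).
Proof. by case=> [y|] //=; rewrite opprK. Qed.

Lemma piX_eq P Q : (piX P == piX Q) = (P == Q) || (P == omap -%R Q).
Proof.
case: P Q => [y|] [z|] //=; rewrite !(inj_eq Some_inj) -eqf_sqr.
by rewrite (inj_eq (mulfI cube4_neq0)) (inj_eq (addIr _)).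
Qed.

Lemma piY_eq P Q : (piY P == piY Q) = (P == Q) || (P == omap -%R Q).
Proof.
case: P Q => [y|] [z|] //=; rewrite !(inj_eq Some_inj) -eqf_sqr.
by rewrite (inj_eq (mulfI cube12_neq0)) (inj_eq (addrI _)) eqr_opp.
Qed.

Lemma j1728E : j1728 = affine 1728%:R.
Proof. by rewrite natr1728 cube12 /j1728 /=; congr Some; ring. Qed.

Lemma piY0 : piY (Some 0) = j1728.
Proof. by rewrite /j1728 /= cube12; congr Some; ring. Qed.

Lemma piXN P : piX (omap -%R P) = piX P.
Proof. by apply/eqP; rewrite piX_eq eqxx orbT. Qed.

Lemma piYN P : piY (omap -%R P) = piY P.
Proof. by apply/eqP; rewrite piY_eq eqxx orbT. Qed.

Lemma special_piX P : special (piX P) = two_torsion P.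
Proof.
rewrite /special -[infty]/(piX None) !piX_eq /= oppr0.
by rewrite -orbA orbCA orbA !orbb.
Qed.

Lemma special_piY P : special (piY P) = two_torsion P.
Proof.
rewrite /special -[infty]/(piY None) -piY0 !piY_eq /= oppr0.
by rewrite -orbA orbCA orbA !orbb.
Qed.

(** Equal affine j-values give y^2 = -27 z^2, which forces y = z = 0 since -27 is not a square. *)
Lemma piX_piY P Q : piX P = piY Q -> special (piX P).
Proof.
move=> PQ; rewrite special_piX; case: P Q PQ => [y|] [z|] //= [].
rewrite cube12 [27%:R * _]mulrC -[X in _ = X]mulrA.
move=> h; have e := mulfI cube4_neq0 h.
have {}e : y ^+ 2 = z ^+ 2 * curveN27.
  have -> : y ^+ 2 = y ^+ 2 + 27%:R - 27%:R by ring.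
  by rewrite e /curveN27; ring.
rewrite /two_torsion /= (inj_eq Some_inj).
have -> : (y == 0) = (y ^+ 2 == 0) by rewrite expf_eq0.
rewrite e.
have [->|z0] := eqVneq z 0; first by rewrite expr0n mul0r.
have /negP[] := sqr_neq_curveN27 (y / z).
by rewrite expr_div_n e mulrC mulKf ?expf_neq0.
Qed.

Lemma card_pi_image (pi : option F -> P1 F) (S : {set option F}) :
    (forall P Q, (pi P == pi Q) = (P == Q) || (P == omap -%R Q)) ->
    {in S, forall P, omap -%R P \in S} ->
    {in S, forall P, ~~ two_torsion P} ->
  #|S| = (2 * #|pi @: S|)%N.
Proof.
move=> pi_eq S_N S2; rewrite mulnC -sum_nat_const -sum1_card.
rewrite (partition_big pi (mem (pi @: S))) /=; last by move=> P SP; apply: imset_f.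
apply: eq_bigr => _ /imsetP[P SP ->]; rewrite sum1dep_card.
rewrite (_ : [set _ | _] = [set P; omap -%R P]); last first.
  apply/setP=> Q; rewrite !inE pi_eq; apply/andP/orP => [[_ /orP]//|h].
  by split; [case: h => /eqP->; rewrite ?S_N|apply/orP].
by rewrite cards2 eq_omapN S2.
Qed.

(** * The two sides of the j-line and the indegrees *)

Definition isX (Q : P1 F) := [exists P, piX P == Q].

Lemma isX_piX P : isX (piX P).
Proof. by apply/existsP; exists P. Qed.

Lemma isX_piY P : isX (piY P) = two_torsion P.
Proof.
rewrite -special_piY; apply/existsP/idP => [[Q /eqP e]|/orP[]/eqP->].
- by rewrite -e; apply: piX_piY e.
- by exists None.
- by exists (Some 0).
Qed.

(** Counting: off the 2-torsion both quotient maps are 2-to-1, so each image has (q - 1)/2 elements.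
    The images are disjoint, hence fill the q - 1 non-special points. *)
Lemma not_isXP Q : ~~ isX Q -> exists2 P, ~~ two_torsion P & Q = piY P.
Proof.
pose U := [set P : option F | ~~ two_torsion P].
pose V := [set Q : P1 F | ~~ special Q].
have UN : {in U, forall P, omap -%R P \in U}.
  by move=> P; rewrite !inE two_torsionN.
have U2 : {in U, forall P, ~~ two_torsion P} by move=> P; rewrite inE.
have cX := card_pi_image piX_eq UN U2.
have cY := card_pi_image piY_eq UN U2.
have disj : [disjoint piX @: U & piY @: U].
  apply/pred0P => R /=; apply/andP => -[/imsetP[P UP ->] /imsetP[P' UP' e]].
  by have := piX_piY e; rewrite special_piX (negPf (U2 _ UP)).
have UV : piX @: U :|: piY @: U = V.
  apply/eqP; rewrite eqEcard; apply/andP; split.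
    apply/subsetP => _ /setUP[]/imsetP[P UP ->]; rewrite inE.
      by rewrite special_piX U2.
    by rewrite special_piY U2.
  rewrite cardsU disjoint_setI0 // cards0 subn0.
  rewrite -(leq_pmul2l (isT : 0 < 2)%N) mulnDr -cX -cY addnn mul2n leq_double.
  have cV : V = ~: [set infty; j1728] by apply/setP => R; rewrite !inE.
  have cU : U = ~: [set None; Some 0] by apply/setP => R; rewrite !inE.
  by rewrite cV cU [X in (X <= _)%N]cardsCs [X in (_ <= X)%N]cardsCs !setCK !cards2.
move=> nX; have : Q \in V.
  rewrite inE; apply: contra nX => /orP[]/eqP->; first exact: (isX_piX None).
  exact: isX_piX.
rewrite -UV => /setUP[]/imsetP[P UP QE]; first by rewrite QE isX_piX in nX.
by exists P => //; apply: U2.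
Qed.

Lemma alpha_two_torsion P : two_torsion (alpha P) = two_torsion P.
Proof.
have a0 : alpha (Some 0) = Some 0.
  by rewrite /alpha /= (negPf (sqr_neq_curveN27 0)) !mul0r.
by rewrite /two_torsion -{1}a0 -{1}[None]/(alpha None) !(inj_eq alpha_inj).
Qed.

Lemma isX_Hess Q : ~~ special Q -> isX (Hess Q) = ~~ isX Q.
Proof.
have [/existsP[P /eqP <-]|] := boolP (isX Q).
  by rewrite special_piX Hess_piX isX_piY alpha_two_torsion => /negPf.
by move=> /not_isXP[P _ ->] _; rewrite Hess_piY isX_piX.
Qed.

Lemma Hess_special Q : special Q -> Hess Q = Q.
Proof.
move=> /orP[]/eqP->; first by rewrite HessE.
rewrite {1}/j1728 Hess_piX /alpha /=.
by rewrite (negPf (sqr_neq_curveN27 0)) !mul0r piY0.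
Qed.

Lemma isX_special Q : special Q -> isX Q.
Proof. by move=> /orP[]/eqP->; [apply: (isX_piX None)|apply: isX_piX]. Qed.

(** All preimages come from the first curve, where [alpha] is bijective. *)
Lemma indegree_notX Q : ~~ isX Q -> indegree Q = 1%N.
Proof.
move=> nX; have /not_isXP[P nP QE] := nX; have [g gK Kg] := alpha_bij.
apply/eqP/cards1P; exists (piX (g P)); apply/setP=> R; rewrite !inE.
apply/eqP/eqP => [|->]; last by rewrite Hess_piX Kg.
have [/existsP[S /eqP <-]|] := boolP (isX R).
  rewrite Hess_piX QE => /eqP; rewrite piY_eq => /orP[]/eqP e.
    by rewrite -e gK.
  by rewrite -[P]omapNK -e -[omap _ _]isogN_omap gK piXN.
move=> /not_isXP[S _ ->]; rewrite Hess_piY => h.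
by rewrite -h isX_piX in nX.
Qed.

(** All preimages come from the second curve. [R] makes the fiber of [beta] nonempty, hence of size
    3 by [card_T_fiber], and [piY] is injective on it because [P] is not its own opposite. *)
Lemma indegree_isX Q R : isX Q -> ~~ special Q -> Hess R = Q -> indegree Q = 3%N.
Proof.
move=> /existsP[P /eqP <-]; rewrite special_piX => nP hR.
have nXR S : Hess S = piX P -> ~~ isX S.
  apply: contra_eqN => /existsP[S' /eqP <-]; rewrite Hess_piX.
  by apply: contra nP => /eqP/esym/piX_piY; rewrite special_piX.
have lift S : Hess S = piX P -> exists2 S', S = piY S' & beta S' = P.
  move=> hS; have /not_isXP[S' _ SE] := nXR _ hS.
  move: hS; rewrite SE Hess_piY => /eqP; rewrite piX_eq => /orP[]/eqP e.
    by exists S'.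
  exists (omap -%R S'); first by rewrite piYN.
  by rewrite /beta isogN_omap -/(beta S') e omapNK.
have [R' _ R'P] := lift _ hR.
have [g gK Kg] := alpha_bij.
have fib : #|[set S | beta S == P]| = 3%N.
  have curve0 := curveN27_neq0.
  have := @card_T_fiber _ (third curveN27) None dual_step
    (fun P Q => thirdC P Q curve0) (fun P Q => thirdK P Q curve0) erefl
    dual_step_third dual_step_eq_None card_third_flex (g R').
  rewrite /dual_step Kg R'P -(card_imset _ alpha_inj) => <-.
  apply: eq_card => S; rewrite -[S]Kg (mem_imset _ _ alpha_inj) !inE.
  by [].
rewrite -fib /indegree -(card_in_imset (f := piY)); last first.
  move=> S S'; rewrite !inE => /eqP bS /eqP bS' /eqP; rewrite piY_eq.
  move=> /orP[]/eqP // e; move: nP; rewrite -eq_omapN -{1}bS e.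
  by rewrite /beta isogN_omap -/(beta S') bS' eqxx.
apply: eq_card => S; rewrite !inE; apply/eqP/imsetP => [/lift[S' -> b]|].
  by exists S'; rewrite ?inE ?b.
by move=> [S']; rewrite inE => /eqP b ->; rewrite Hess_piY b.
Qed.

(** * Multiplicities of preimages *)

Lemma mup_simple (p : {poly F}) x : root p x -> ~~ root p^`() x -> mup x p = 1%N.
Proof.
move=> px dpx; have p0 : p != 0.
  by apply: contraNneq dpx => ->; rewrite deriv0 root0.
apply/eqP; rewrite eqn_leq -XsubC_dvd // dvdp_XsubCl px andbT mup_leq //.
apply: contra dpx => /dvdpP[r ->].
rewrite expr2 rootE !(derivM, hornerXsubC, hornerM, hornerD) subrr.
by apply/eqP; ring.
Qed.

Lemma mup_scale (a x : F) (p : {poly F}) : a != 0 -> mup x (a *: p) = mup x p.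
Proof. by move=> a0; rewrite -mul_polyC mupMr // rootC. Qed.

Lemma Hess_affine b x : Hess (Some x) = Some b ->
  x != 0 /\ 27%:R * b * x ^+ 2 = - (x - 4%:R * 12%:R ^+ 3) ^+ 3.
Proof.
rewrite HessE; case: eqP => // /eqP x0 [<-]; split=> //; field.
by rewrite x0 (natr23_neq0 0 3).
Qed.

Lemma mult_simple (P Q : P1 F) : ~~ special P -> P != affine 0 -> Hess Q = P ->
  mult P Q = 1%N.
Proof.
case: P => [b|] //; case: Q => [x|]; last by rewrite HessE.
move=> nb b0 hx; have [x0 e] := Hess_affine hx.
rewrite /mult /coords natr6912 scale1r; apply: mup_simple.
  by rewrite rootE hornerD hornerZ hornerXn horner_exp hornerXsubC e addrN.
rewrite derivD derivZ deriv_exp derivXsubC derivXn mul1r rootE /=.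
rewrite hornerD !hornerZ !hornerMn hornerX horner_exp hornerXsubC.
have j1728m : j1728 = Some (12%:R ^+ 3) by rewrite j1728E natr1728.
have {}nb : b != 12%:R ^+ 3.
  by apply: contraNneq nb => ->; rewrite -j1728m /special eqxx orbT.
have m0 := cube12_neq0; have n27 : 27%:R != 0 :> F by exact: (natr23_neq0 0 3).
have {}b0 : b != 0 by apply: contraNneq b0 => ->.
have mE : 27%:R * 64%:R * (12%:R ^+ 3) ^+ 3 = (12%:R * 12%:R ^+ 3) ^+ 3 :> F.
  by rewrite [RHS]exprMn; congr (_ * _); ring.
move: (12%:R ^+ 3) m0 nb e mE => m m0 nb e mE.
apply/negP => /eqP dx.
(* For the cubic f this is x f' - 2f. Its zeros are the critical points 4m and -8m, lying over 0 and
   1728 = m. *)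
have : (x - 4%:R * m) ^+ 2 * (x + 8%:R * m) = 0.
  transitivity (x * ((x - 4%:R * m) ^+ 2 *+ 3 + 27%:R * b * (x *+ 2)) -
      2%:R * (27%:R * b * x ^+ 2 + (x - 4%:R * m) ^+ 3)); first by ring.
  by rewrite dx e addNr !mulr0 subr0.
move/eqP; rewrite mulf_eq0 expf_eq0 /= => /orP[/eqP x4|].
  move/eqP: e; rewrite x4 expr0n /= oppr0.
  by apply/negP; rewrite !mulf_neq0.
rewrite addr_eq0 => /eqP x8; move/eqP: nb; apply.
have z : 27%:R * 64%:R * m ^+ 2 != 0.
  by rewrite !mulf_neq0 ?expf_neq0 // (natr23_neq0 6 0).
apply: (mulIf z); transitivity (27%:R * b * x ^+ 2); first by rewrite x8; ring.
transitivity ((12%:R * m) ^+ 3); first by rewrite e x8; ring.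
by rewrite -mE; ring.
Qed.

Lemma mult_infty :
  mult (infty : P1 F) infty = 1%N /\ mult infty (affine (0 : F)) = 2%N.
Proof.
rewrite /mult /coords /= !scale0r !add0r mulr1.
have X1 : ('X : {poly F}) = ('X - 0%:P) ^+ 1 by rewrite polyC0 subr0.
have X2 : ('X^2 : {poly F}) = ('X - 0%:P) ^+ 2 by rewrite polyC0 subr0.
by rewrite !mup_scale ?(natr23_neq0 0 3) // X2 {1}X1 !mup_XsubCX eqxx.
Qed.

Lemma mult_j1728 : mult j1728 j1728 = 1%N /\
  mult j1728 (affine (- 8%:R * 12%:R ^+ 3)) = 2%N.
Proof.
have a0 : 12%:R ^+ 3 != 0 :> F := cube12_neq0.
rewrite j1728E natr1728 /mult /coords /affine natr6912 scale1r.
move: (12%:R ^+ 3) a0 => a a0.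
(* Over a = 1728 the cubic splits with the double root -8a. *)
have -> : ('X - (4%:R * a)%:P) ^+ 3 + (27%:R * a) *: 'X^2 =
    ('X - a%:P) * ('X - (- 8%:R * a)%:P) ^+ 2 :> {poly F}.
  by rewrite -mul_polyC !polyCM polyCN !polyC_natr; ring.
have a8 : a != - 8%:R * a.
  rewrite -subr_eq0; have -> : a - - 8%:R * a = 9%:R * a by ring.
  by rewrite mulf_neq0 // (natr23_neq0 0 2).
have a8' : - 8%:R * a != a by rewrite eq_sym.
split; [rewrite mupMl | rewrite mupMr];
  rewrite ?rootE ?horner_exp ?hornerXsubC ?expf_neq0 ?subr_eq0 //.
  by rewrite -['X - _]expr1 mup_XsubCX eqxx.
by rewrite mup_XsubCX eqxx.
Qed.

Lemma preim_infty Q : Hess Q = infty -> Q = infty \/ Q = affine 0.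
Proof.
by case: Q => [x|]; rewrite HessE; [case: eqP => // -> _; right|left].
Qed.

Lemma preim_j1728 Q : Hess Q = j1728 ->
  Q = j1728 \/ Q = affine (- 8%:R * 12%:R ^+ 3).
Proof.
have j1728m : j1728 = Some (12%:R ^+ 3) by rewrite j1728E natr1728.
case: Q => [x|]; last by rewrite HessE.
rewrite j1728m => /Hess_affine[_ e].
have : (x - 12%:R ^+ 3) * (x + 8%:R * 12%:R ^+ 3) ^+ 2 == 0.
  move: (12%:R ^+ 3) e => m e; apply/eqP.
  transitivity ((x - 4%:R * m) ^+ 3 + 27%:R * m * x ^+ 2); first by ring.
  by rewrite e addrN.
rewrite mulf_eq0 subr_eq0 expf_eq0 /= addr_eq0 -mulNr.
by move=> /orP[]/eqP->; [left|right].
Qed.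

Lemma Hess0 : Hess (affine (0 : F)) = infty.
Proof. by rewrite HessE /= eqxx. Qed.

Lemma Hess_critical : Hess (affine (- 8%:R * 12%:R ^+ 3)) = j1728.
Proof.
rewrite HessE j1728E natr1728 /= mulf_eq0 oppr_eq0 (negPf cube12_neq0).
rewrite -[8%:R == 0]negbK (natr23_neq0 3 0) /=; congr Some.
have := cube12_neq0; have := natr23_neq0 0 3; have := natr23_neq0 3 0.
have : (8%:R + 4%:R) ^+ 3 = 27%:R * 8%:R ^+ 2 :> F by ring.
rewrite -[(2 ^ 3 * _)%:R]/(8%:R) -[(2 ^ 0 * _)%:R]/(27%:R).
move: (12%:R ^+ 3) 8%:R 27%:R 4%:R => m a b c e a0 b0 m0.
have -> : - (- a * m - c * m) ^+ 3 = (a + c) ^+ 3 * m ^+ 3 by ring.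
by rewrite e; field; rewrite b0 oppr_eq0 a0 m0.
Qed.

Lemma zero_neq_special : ~~ special (affine 0).
Proof.
(* The points with y^2 = 1 are the affine part of the kernel of [beta]; they lie over j = 0. *)
have -> : affine 0 = piY (Some 1) by rewrite /= expr1n subrr mulr0.
by rewrite special_piY /two_torsion /= (inj_eq Some_inj) oner_eq0.
Qed.

Lemma isX_neq0 Q : isX Q -> Q != affine 0.
Proof.
have -> : affine 0 = piY (Some 1) by rewrite /= expr1n subrr mulr0.
apply: contraTneq => ->.
by rewrite isX_piY /two_torsion /= (inj_eq Some_inj) oner_eq0.
Qed.

Lemma critical_neq_special : ~~ special (affine (- 8%:R * 12%:R ^+ 3)).
Proof.
rewrite /special /= j1728E natr1728 /affine (inj_eq Some_inj) -subr_eq0.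
have -> : - 8%:R * 12%:R ^+ 3 - 12%:R ^+ 3 = - (9%:R * 12%:R ^+ 3) :> F by ring.
by rewrite oppr_eq0 mulf_neq0 ?cube12_neq0 // (natr23_neq0 0 2).
Qed.

(* At 1728 and infinity the double preimage is a critical point of Hess. *)
Lemma special_preim Q : special Q -> exists2 R : P1 F,
  [/\ ~~ special R, Hess R = Q & forall S, Hess S = Q -> S = Q \/ S = R] &
  mult Q Q = 1%N /\ mult Q R = 2%N.
Proof.
move=> /orP[]/eqP->.
  exists (affine 0); last exact: mult_infty.
  by split; [exact: zero_neq_special|exact: Hess0|exact: preim_infty].
exists (affine (- 8%:R * 12%:R ^+ 3)); last exact: mult_j1728.
by split; [exact: critical_neq_special|exact: Hess_critical|exact: preim_j1728].
Qed.

Lemma indegree_multE Q : ~~ special Q -> Q != affine 0 ->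
  indegree_mult Q = indegree Q.
Proof.
move=> sQ Q0; rewrite /indegree_mult /indegree -sum1dep_card.
by apply: eq_bigr => R /eqP hR; apply: mult_simple.
Qed.

Lemma indegree_mult_special Q : special Q -> indegree_mult Q = 3%N.
Proof.
move=> sQ; have [R [sR hR hS] [m1 m2]] := special_preim sQ.
have RQ : R != Q by apply: contraNneq sR => ->.
rewrite /indegree_mult (bigD1 Q) ?Hess_special ?eqxx //= m1.
rewrite (bigD1 R) ?hR ?eqxx //= m2 big1 // => S /andP[/andP[/eqP/hS h SQ] SR].
by case: h SQ SR => ->; rewrite eqxx.
Qed.

(** * Periodic points and levels *)

Section Periodic.

Variables d N : nat.
Hypothesis card_F1 : #|F|.+1 = (3 ^ d * N)%N.
Hypothesis coprime_3N : coprime 3 N.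

Local Notation core := (core dual_step d).

Let opC P Q : third curveN27 P Q = third curveN27 Q P :=
  thirdC P Q curveN27_neq0.
Let opK P : involutive (third curveN27 P) :=
  fun Q => thirdK P Q curveN27_neq0.
Let card_X : #|{: option F}| = (3 ^ d * N)%N.
Proof. by rewrite card_option. Qed.

Let core_periodic : forall P, P \in core ->
  exists2 n, (0 < n)%N & iter n dual_step P = P :=
  core_periodic opC opK erefl dual_step_third dual_step_eq_None card_third_flex
    card_X coprime_3N.
Let card_core : #|core| = N :=
  card_core opC opK erefl dual_step_third dual_step_eq_None card_third_flex card_X.
Let iter_coreP : forall n P, (n <= d)%N ->
  (iter n dual_step P \in core) = (P \in iter_im dual_step (d - n)) :=
  iter_coreP opC opK erefl dual_step_third dual_step_eq_None card_third_flex
    card_X.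

Lemma third_None P : third curveN27 P None = omap -%R P.
Proof. by case: P. Qed.

Lemma dual_step_two_torsion P : two_torsion P -> dual_step P = P.
Proof.
move=> /orP[]/eqP-> //; rewrite /dual_step /alpha /=.
rewrite (negPf (sqr_neq_curveN27 0)) !mul0r /= expr0n eq_sym oner_eq0.
by rewrite !mul0r.
Qed.

Lemma core_two_torsion P : two_torsion P -> P \in core.
Proof.
move=> tP; apply/imsetP; exists P => //.
by elim: d => //= n <-; rewrite dual_step_two_torsion.
Qed.

Lemma coreN P : P \in core -> omap -%R P \in core.
Proof.
move=> cP; rewrite -third_None.
by apply: (iter_im_op dual_step_third) => //; apply: core_two_torsion.
Qed.

Lemma iter_Hess_piX n P : iter n.*2 Hess (piX P) = piX (iter n dual_step P).
Proof.
elim: n P => // n IH P.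
by rewrite doubleS !iterSr Hess_piX Hess_piY IH.
Qed.

Lemma iter_Hess_piY n P :
  iter n.*2 Hess (piY (alpha P)) = piY (alpha (iter n dual_step P)).
Proof. by rewrite -!Hess_piX -iterSr iterS iter_Hess_piX. Qed.

Lemma iter_core_ge n P : (d <= n)%N -> iter n dual_step P \in core.
Proof.
exact: im_core.
Qed.

(** If n is a period, 2dn steps of [Hess] give T^(dn) P = P or -P; as dn >= d this lies in the core,
    which is stable under negation. *)
Lemma periodic_piX P : periodic (piX P) = (P \in core).
Proof.
apply/periodicP/idP => [[n n0 nP]|/core_periodic[n n0 nP]].
  have := iter_fix d.*2 nP; rewrite -doubleMr iter_Hess_piX => /eqP.
  rewrite piX_eq => /orP[]/eqP e; last rewrite -[P]omapNK -e coreN //.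
    by rewrite -e iter_core_ge // leq_pmull.
  by rewrite iter_core_ge // leq_pmull.
by exists n.*2; rewrite ?double_gt0 // iter_Hess_piX nP.
Qed.

Lemma periodic_piY_alpha P : periodic (piY (alpha P)) = (P \in core).
Proof.
apply/idP/idP => [/periodicP[n n0 nP]|cP].
  have := iter_fix d.*2 nP; rewrite -doubleMr iter_Hess_piY => /eqP.
  rewrite piY_eq => /orP[/eqP/alpha_inj e|/eqP].
    by rewrite -e iter_core_ge // leq_pmull.
  rewrite /alpha -isogN_omap => /alpha_inj e.
  by rewrite -[P]omapNK -e coreN // iter_core_ge // leq_pmull.
by rewrite -Hess_piX periodic_Hess // periodic_piX.
Qed.

Lemma special_periodic Q : special Q -> periodic Q.
Proof.
by move=> sQ; apply/periodicP; exists 1%N; rewrite //= Hess_special.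
Qed.

(** Special points are fixed, so an orbit that reaches one never leaves it. *)
Lemma periodic_nonspecial Q n :
  periodic Q -> ~~ special Q -> ~~ special (iter n Hess Q).
Proof.
move=> /periodicP[m m0 mQ]; apply: contra => sn.
have := iter_fix n.+1 mQ; rewrite -(subnK (_ : n <= m * n.+1)%N); last first.
  by rewrite (leq_trans (leqnSn n)) ?leq_pmull.
by rewrite iterD => <-; elim: (_ - _)%N => //= k IH; rewrite Hess_special.
Qed.

Lemma isX_iter Q n : periodic Q -> ~~ special Q ->
  isX (iter n Hess Q) = isX Q (+) odd n.
Proof.
move=> pQ sQ; elim: n => [|n IH]; first by rewrite addbF.
by rewrite iterS isX_Hess ?periodic_nonspecial // IH /= -addbN.
Qed.

(** Without the two 2-torsion points the core has N - 2 elements. It contributes (N - 2)/2 periodic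
    points on each side, and the two special points complete the count. *)
Lemma card_periodic : #|[set P : P1 F | periodic P]| = N.
Proof.
pose U := [set P in core | ~~ two_torsion P].
have UN : {in U, forall P, omap -%R P \in U}.
  by move=> P; rewrite !inE two_torsionN => /andP[/coreN-> ->].
have U2 : {in U, forall P, ~~ two_torsion P}.
  by move=> P; rewrite inE => /andP[].
have VN : {in alpha @: U, forall P, omap -%R P \in alpha @: U}.
  by move=> _ /imsetP[P UP ->]; rewrite -isogN_omap; apply/imset_f/UN.
have V2 : {in alpha @: U, forall P, ~~ two_torsion P}.
  by move=> _ /imsetP[P UP ->]; rewrite alpha_two_torsion U2.
have cX := card_pi_image piX_eq UN U2.
have := card_pi_image piY_eq VN V2; rewrite card_imset; last exact: alpha_inj.
rewrite cX => /eqP; rewrite eqn_pmul2l // => /eqP cXY.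
have cU : N = (#|U| + 2)%N.
  rewrite -card_core -(cardsID [set None; Some 0] core) addnC; congr (_ + _)%N.
    by apply: eq_card => P; rewrite !inE andbC.
  have /setIidPr -> : [set None; Some 0] \subset core.
    by apply/subsetP=> P; rewrite !inE => tP; apply: core_two_torsion.
  by rewrite cards2.
have sE : [set Q | special Q] = [set infty; j1728] by apply/setP=> Q; rewrite !inE.
have -> : [set P : P1 F | periodic P] =
    [set Q | special Q] :|: (piX @: U :|: piY @: (alpha @: U)).
  have [g gK Kg] := alpha_bij.
  apply/setP=> Q; rewrite !inE; apply/idP/or3P => [pQ|[]].
  - have [|sQ] := boolP (special Q); [by constructor 1|].
    have [/existsP[P /eqP PQ]|/not_isXP[P nP PQ]] := boolP (isX Q).
      constructor 2; apply/imsetP; exists P => //.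
      by rewrite inE -periodic_piX -special_piX PQ pQ.
    constructor 3; apply/imsetP; exists P => //; rewrite -[P]Kg imset_f // inE.
    by rewrite -periodic_piY_alpha -alpha_two_torsion Kg -PQ pQ.
  - exact: special_periodic.
  - by move=> /imsetP[P + ->]; rewrite inE periodic_piX => /andP[].
  - move=> /imsetP[_ /imsetP[P + ->] ->].
    by rewrite inE periodic_piY_alpha => /andP[].
rewrite cardsU disjoint_setI0; last first.
  apply/pred0P => Q /=; rewrite !inE; apply/andP => -[sQ].
  move=> /orP[]/imsetP[P hP QE].
    by move: sQ; rewrite QE special_piX (negPf (U2 _ hP)).
  by move: sQ; rewrite QE special_piY (negPf (V2 _ hP)).
rewrite cards0 subn0 [X in (_ + X)%N]cardsU disjoint_setI0; last first.
  apply/pred0P => Q /=; apply/andP => -[/imsetP[P hP ->] /imsetP[P' _ e]].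
  by have := piX_piY e; rewrite special_piX (negPf (U2 _ hP)).
rewrite cards0 subn0 -cXY addnn -mul2n -cX cU addnC sE cards2; congr (_ + _)%N.
Qed.

Let d_gt0 : (0 < d)%N.
Proof.
rewrite lt0n; apply: contraTneq coprime_3N => d0.
move: card_F1; rewrite d0 expn0 mul1n => <-.
by rewrite prime_coprime // negbK /dvdn -addn1 -modnDml F_mod3.
Qed.

Lemma nonperiodic_nonspecial Q : ~~ periodic Q -> ~~ special Q.
Proof. exact: contra (@special_periodic Q). Qed.

(** * Levels and arities in the trees *)

Lemma node_isX P n Q : isX P -> node P n Q -> isX Q = ~~ odd n.
Proof.
move=> XP; elim: n Q => [Q [/= -> _] //|n IH Q /nodeS[nQ _ pQ]].
rewrite -[isX Q]negbK -isX_Hess ?nonperiodic_nonspecial //.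
by rewrite (IH _ nQ).
Qed.

Lemma periodic_iter_ge Q n : isX Q -> (d.*2 <= n)%N -> periodic (iter n Hess Q).
Proof.
move=> /existsP[P /eqP <-] le_n; rewrite -(subnK le_n) iterD iter_Hess_piX.
elim: (_ - _)%N => [|k IH]; last exact: periodic_Hess.
by rewrite periodic_piX iter_core_ge.
Qed.

Lemma node_le P n Q : isX P -> node P n Q -> (n <= d.*2)%N.
Proof.
move=> XP nQ; have XQ := node_isX XP nQ; have [_ pQ] := nQ.
rewrite leqNgt; apply/negP => lt_n.
have [XQ'|nXQ] := boolP (isX Q).
  by have [_ /negP[]] := pQ _ lt_n; apply: periodic_iter_ge.
have /not_isXP[S _ QS] := nXQ; have [g gK Kg] := alpha_bij.
(* Off the X side, [Q] itself has a preimage on the X side, so it becomes periodic one step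
   earlier. *)
have [|_ /negP[]] := pQ d.*2.-1.
  by rewrite (leq_trans _ lt_n) // ltnS leq_pred.
rewrite QS -[S]Kg -Hess_piX -iterSr prednK ?double_gt0 //.
by rewrite periodic_iter_ge ?isX_piX.
Qed.

(** Meant for n > 0: the root has one preimage on its own cycle and is treated apart. *)
Definition arity n := if odd n then 1%N else if (n < d.*2)%N then 3%N else 0%N.

(** At depth 2k the node is [piX y] with T^k y in the core, so [iter_coreP] puts y in the image of
    T^(d - k). For k < d this provides a preimage, hence three; for k = d a preimage would have
    depth 2d + 1. *)
Lemma node_arity P n Q : periodic P -> isX P -> node P n.+1 Q ->
  indegree Q = arity n.+1.
Proof.
move=> pP XP nQ; have [_ _ pQ] := (nodeS _ _ _).1 nQ.
have sQ := nonperiodic_nonspecial pQ.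
have XQ := node_isX XP nQ; rewrite /arity.
have [odd_n|even_n] := boolP (odd n.+1).
  by apply: indegree_notX; rewrite XQ odd_n.
rewrite even_n in XQ; move: (even_n); have := nQ.
rewrite -(even_halfK even_n); set k := (n.+1)./2 => nkQ _.
have /existsP[y /eqP yQ] := XQ.
have cy : iter k dual_step y \in core.
  by have [nkP _] := nkQ; rewrite -periodic_piX -iter_Hess_piX yQ nkP.
rewrite ltn_double; case: ltnP => [lt_k|le_dk].
  move: cy; rewrite iter_coreP ?(ltnW lt_k) //.
  rewrite -(prednK (_ : 0 < d - k)%N) ?subn_gt0 // => /imsetP[z _ yz].
  pose R := piY (alpha (iter (d - k).-1 dual_step z)).
  apply: (@indegree_isX Q R) => //.
  by rewrite Hess_piY -[beta _]/(iter (d - k).-1.+1 dual_step z) -yz yQ.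
have k_gt0 : (0 < k)%N by apply: leq_trans le_dk.
apply/eqP; rewrite cards_eq0; apply/eqP/setP=> R; rewrite !inE.
apply/negP => /eqP hR.
have nXR : ~~ isX R.
  have [/existsP[z /eqP zR]|//] := boolP (isX R).
  move: hR; rewrite -zR Hess_piX -yQ => /esym/piX_piY.
  by rewrite yQ (negPf sQ).
have nR : node P k.*2.+1 R.
  apply/nodeS; rewrite hR; split=> //.
    apply: contraNneq pQ => RP; rewrite -hR RP; exact: periodic_Hess.
  by apply: contra pQ => pR; rewrite -hR; apply: periodic_Hess.
by have := node_le XP nR; rewrite ltn_double ltnNge le_dk.
Qed.

(** A special root has itself as a simple preimage and one other, double preimage; any other root
    has three simple preimages, one of them periodic. With multiplicity there are two branches in
    both cases. *)
Lemma root_edges P : periodic P -> isX P ->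
  [/\ size (children P P) = if special P then 1%N else 2%N
    & size (root_branches P) = 2%N].
Proof.
move=> pP XP; rewrite size_root_branches -cardE.
have [R pR hR] := periodic_preim pP.
have [sP|sP] := boolP (special P).
  have [S [sS hS hP] [_ m2]] := special_preim sP.
  have pS : ~~ periodic S.
    apply: contra sS => pS; suff -> : S = P by [].
    by apply: periodic_Hess_inj => //; rewrite hS Hess_special.
  have edgeE Q : tree_edge P Q P = (Q == S).
    rewrite tree_edge_root //; apply/andP/eqP => [[/eqP/hP[]-> //]|->].
      by rewrite pP.
    by rewrite hS eqxx.
  split; last by rewrite (big_pred1 S).
  by apply/eqP/cards1P; exists S; apply/setP=> Q; rewrite !inE edgeE.
have c2 : #|[set Q | tree_edge P Q P]| = 2%N.
  have := indegree_isX XP sP hR; rewrite /indegree (cardsD1 R) inE hR eqxx.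
  move=> [<-]; apply: eq_card => Q; rewrite !inE tree_edge_root // andbC.
  have [hQ|_] := eqVneq (Hess Q) P; last by rewrite !andbF.
  rewrite !andbT; apply/idP/idP => [|QR]; first by apply: contraNneq => ->.
  by apply: contraNN QR => pQ; apply/eqP/periodic_Hess_inj; rewrite // hR.
split=> //; rewrite -[RHS]c2 -sum1dep_card; apply: eq_bigr => Q.
rewrite tree_edge_root // => /andP[/eqP hQ _].
by apply: mult_simple; rewrite ?isX_neq0.
Qed.

(** Arities depend only on the depth, except that the number of children of the root also depends on
    whether it is special. *)
Lemma root_tree_iso P P' : periodic P -> periodic P' -> isX P -> isX P' ->
  special P = special P' -> tree_iso P P'.
Proof.
move=> pP pP' XP XP' sPP'.
pose c n := if n is 0 then if special P then 1%N else 2%N else arity n.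
have regular R : periodic R -> isX R -> special R = special P ->
    forall Q, Q \in tree R -> size (children R Q) = c (depth R Q).
  move=> pR XR sR Q tQ; have [->|QR] := eqVneq Q R.
    by rewrite depth_root /c -sR; case: (root_edges pR XR).
  have [_ dQ pQ] := tree_Hess tQ QR; rewrite size_children // dQ.
  by apply: (node_arity pR XR); rewrite -dQ; apply: tree_node.
by apply: (@tree_iso_regular _ c); apply: regular.
Qed.

Lemma branch_tree_iso P P' Q Q' : periodic P -> periodic P' -> isX P -> isX P' ->
  tree_edge P Q P -> tree_edge P' Q' P' -> tree_iso Q Q'.
Proof.
have regular R S : periodic R -> isX R -> tree_edge R S R ->
    forall T, T \in tree S -> size (children S T) = arity (depth S T).+1.
  move=> pR XR eS T tT; have nT := node_branch pR eS (tree_node tT).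
  have [_ _ pT] := (nodeS _ _ _).1 nT.
  by rewrite size_children //; apply: node_arity nT.
move=> pP pP' XP XP' eQ eQ'.
by apply: (@tree_iso_regular _ (fun n => arity n.+1));
  [apply: (regular P)|apply: (regular P')].
Qed.

Lemma root_tree_iso_mult P P' : periodic P -> periodic P' -> isX P -> isX P' ->
  tree_iso_mult P P'.
Proof.
move=> pP pP' XP XP'; exists (root_branches P').
have [_ sP] := root_edges pP XP; have [_ sP'] := root_edges pP' XP'.
split=> [||i]; rewrite ?perm_refl ?sP ?sP' // => lt_i.
apply: (branch_tree_iso pP pP' XP XP'); apply: mem_root_branches;
  by rewrite mem_nth ?sP ?sP'.
Qed.

Lemma leaf_children P Q : Q \in tree P -> leaf P Q = (children P Q == [::]).
Proof.
move=> tQ; rewrite /leaf tQ -size_eq0 -cardE cards_eq0.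
apply/existsPn/eqP => [h|h R].
  by apply/setP=> R; rewrite !inE (negPf (h R)).
by have := in_set0 R; rewrite -h inE => ->.
Qed.

Lemma root_not_leaf P : periodic P -> isX P -> ~~ leaf P P.
Proof.
move=> pP XP; rewrite leaf_children ?root_tree // -size_eq0.
by have [-> _] := root_edges pP XP; case: ifP.
Qed.

Lemma tree_shape P Q : periodic P -> isX P -> Q \in tree P ->
  [/\ leaf P Q -> depth P Q = (2 * d)%N /\ indegree Q = 0%N,
      ~~ leaf P Q -> ~~ odd (depth P Q) ->
        indegree_mult Q = 3%N /\ (~~ special Q -> indegree Q = 3%N)
    & odd (depth P Q) -> indegree Q = 1%N].
Proof.
move=> pP XP tQ; have [->|QP] := eqVneq Q P.
  rewrite depth_root; split=> // [lP|_ _].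
    by rewrite (negPf (root_not_leaf pP XP)) in lP.
  have [sP|sP] := boolP (special P); first by rewrite indegree_mult_special.
  have [R _ hR] := periodic_preim pP.
  by rewrite indegree_multE ?isX_neq0 // (indegree_isX XP sP hR).
have [_ dQ pQ] := tree_Hess tQ QP; have nQ := tree_node tQ.
rewrite leaf_children // -size_eq0 size_children //.
have XQ := node_isX XP nQ; have le_n := node_le XP nQ.
rewrite dQ in nQ XQ le_n *; have := node_arity pP XP nQ.
rewrite /arity; case: ifP => [_ ->|even_n]; first by split.
case: ltnP => [lt_n e|le_dn e]; split; rewrite ?e //.
  move=> _ _; split=> //; rewrite indegree_multE //.
    exact: nonperiodic_nonspecial.
  by rewrite isX_neq0 // XQ even_n.
by move=> _; split=> //; apply/eqP; rewrite mul2n eqn_leq le_n.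
Qed.

(** A special point has only two distinct preimages. *)
Lemma isX_indegree P : indegree P = 3%N -> isX P /\ ~~ special P.
Proof.
have [XP|/indegree_notX->//] := boolP (isX P); have [sP|//] := boolP (special P).
have [R [sR hR hS] _] := special_preim sP.
rewrite /indegree (_ : [set Q | _] = [set P; R]); first by rewrite cards2; case: eqP.
apply/setP=> Q; rewrite !inE.
apply/eqP/orP => [/hS[]->|[]/eqP->]; rewrite ?eqxx.
- by left.
- by right.
- exact: Hess_special.
- exact: hR.
Qed.

(** The point 0 also has total multiplicity 3, from a triple preimage, but it is not periodic: it
    maps to the fixed point infinity. *)
Lemma isX_indegree_mult P : periodic P -> indegree_mult P = 3%N -> isX P.
Proof.
move=> pP; have [//|nX] := boolP (isX P).
rewrite indegree_multE ?indegree_notX //; first by apply: contra nX; apply: isX_special.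
apply: contraTneq pP => ->; apply/negP => p0; move: zero_neq_special.
have soo : special infty by rewrite /special eqxx.
suff -> : affine 0 = infty :> P1 F by rewrite soo.
apply: periodic_Hess_inj => //; first exact: special_periodic.
by rewrite Hess0 Hess_special.
Qed.

(** Each step changes the side of the j-line, so a cycle closes up only after an even number of
    steps. *)
Lemma cycle_alternates P : periodic P -> ~~ special P ->
  ~~ odd (order Hess P) /\
  (indegree P = 1%N /\ indegree (Hess P) = 3%N \/
   indegree P = 3%N /\ indegree (Hess P) = 1%N).
Proof.
move=> pP sP; split.
  have := isX_iter (order Hess P) pP sP; rewrite periodic_order //.
  by case: (isX P); case: (odd _).
have [R _ hR] := periodic_preim pP; have sHP := periodic_nonspecial 1 pP sP.
have XHP := isX_Hess sP; have [XP|nXP] := boolP (isX P); [right|left].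
  by rewrite (indegree_isX XP sP hR) indegree_notX // XHP XP.
rewrite indegree_notX //; split=> //.
by apply: (@indegree_isX _ P); rewrite ?XHP.
Qed.

End Periodic.
End Curve.

Theorem theorem5p8 (p k q d N : nat) (F : finFieldType)
    (p_prime : prime p) (p_neq2 : p <> 2) (p_neq3 : p <> 3)
    (k_gt0 : 0 < k) (q_def : q = p ^ k) (card_F : #|F| = q)
    (q_mod3 : q = 2 %[mod 3])
    (q1_def : q.+1 = 3 ^ d * N) (coprime_3N : coprime 3 N) :
  let P1728 : P1 F := affine (1728%:R)%R in
  [/\ #|[set P : P1 F | periodic P]| = N,
      Hess infty = infty :> P1 F /\ indegree_mult (infty : P1 F) = 3,
      Hess P1728 = P1728 /\ indegree_mult P1728 = 3
    & forall P : P1 F, periodic P -> P <> infty -> P <> P1728 ->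
        ~~ odd (order Hess P) /\
        (indegree P = 1 /\ indegree (Hess P) = 3 \/
         indegree P = 3 /\ indegree (Hess P) = 1)]
  /\
  [/\ forall P P' : P1 F, periodic P -> periodic P' ->
        indegree P = 3 -> indegree P' = 3 -> tree_iso P P',
      tree_iso infty P1728,
      forall P P' : P1 F, periodic P -> periodic P' ->
        indegree_mult P = 3 -> indegree_mult P' = 3 -> tree_iso_mult P P'
    & forall P Q : P1 F, periodic P -> indegree_mult P = 3 -> Q \in tree P ->
        [/\ leaf P Q -> depth P Q = 2 * d /\ indegree Q = 0,
            ~~ leaf P Q -> ~~ odd (depth P Q) ->
              indegree_mult Q = 3 /\
              (Q <> infty -> Q <> P1728 -> indegree Q = 3)
          & odd (depth P Q) -> indegree Q = 1]].

Proof.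
have p_char : p \in [pchar F]%R.
  by apply: (card_finPcharP (n := k)); rewrite ?card_F.
have neq0 r : prime r -> p <> r -> (r%:R != 0 :> F)%R.
  move=> r_prime pr; rewrite -(dvdn_pcharf p_char) dvdn_prime2 //.
  exact/eqP.
have nz2 := neq0 2 isT p_neq2; have nz3 := neq0 3 isT p_neq3.
have F_mod3 : #|F| = 2 %[mod 3] by rewrite card_F.
have card_F1 : #|F|.+1 = 3 ^ d * N by rewrite card_F.
move=> P1728; have P1728E : P1728 = j1728 F by rewrite j1728E.
have s8 : special P1728 by rewrite P1728E /special eqxx orbT.
have soo : special (infty : P1 F) by rewrite /special eqxx.
have nspecial (P : P1 F) : P <> infty -> P <> P1728 -> ~~ special P.
  by rewrite P1728E => /eqP/negPf Poo /eqP/negPf P8; rewrite /special Poo P8.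
have sper := special_periodic F_mod3 nz2 nz3.
have sX := isX_special.
split; split.
- exact: (card_periodic F_mod3 nz2 nz3 card_F1 coprime_3N).
- by split; [apply: Hess_special|apply: indegree_mult_special].
- by split; [apply: Hess_special|apply: indegree_mult_special].
- move=> P pP Poo P8; apply: cycle_alternates => //; exact: nspecial.
- move=> P P' pP pP' /isX_indegree[] // XP sP /isX_indegree[] // XP' sP'.
  apply: (root_tree_iso F_mod3 nz2 nz3 card_F1) => //.
  by rewrite (negPf sP) (negPf sP').
- apply: (root_tree_iso F_mod3 nz2 nz3 card_F1) => //;
    by [apply: sper | apply: sX | rewrite s8 soo].
- move=> P P' pP pP' mP mP'.
  by apply: (root_tree_iso_mult F_mod3 nz2 nz3 card_F1) => //;
    apply: isX_indegree_mult.
- move=> P Q pP mP tQ.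
  have XP := isX_indegree_mult F_mod3 nz2 nz3 pP mP.
  have [l e o] := tree_shape F_mod3 nz2 nz3 card_F1 coprime_3N pP XP tQ.
  split=> // nl ev; have [mQ iQ] := e nl ev; split=> // Qoo Q8.
  exact/iQ/nspecial.
Qed.
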